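(* Let $x,y\in\mathbb{R}$, $x^2+y^2>0$, $\varrho\in(-1,1)$, and put $$\varrho_x=\frac{(\varrho x-y)\,\mathrm{sgn}(x)}{\sqrt{x^2-2\varrho xy+y^2}},\qquad \varrho_y=\frac{(\varrho y-x)\,\mathrm{sgn}(y)}{\sqrt{x^2-2\varrho xy+y^2}},\qquad q=\frac{x^2-2\varrho xy+y^2}{2(1-\varrho^2)}.$$ Let $c_k=\frac{(2k)!!}{(2k+1)!!}\,P(k+1,q)$ and $\tilde c_k=\frac{(2k)!!}{(2k+1)!!}\,Q(k+1,q)$ for integers $k\ge0$. Then $$\Phi_\varrho^2(x,y)=\frac12(\Phi(x)+\Phi(y))+\frac{\arcsin\varrho_x+\arcsin\varrho_y}{2\pi}-S-\beta=\frac12(\Phi(x)+\Phi(y))+\tilde S-\beta,$$ where $$S=\frac{1}{2\pi\sqrt{2q}}\sum_{k=0}^\infty c_k\left(|x|\,\varrho_x^{2k+1}+|y|\,\varrho_y^{2k+1}\right),$$ $\tilde S$ is $S$ with $\tilde c_k$ instead of $c_k$, that is, $$\tilde S=\frac{1}{2\pi\sqrt{2q}}\sum_{k=0}^\infty\tilde c_k\left(|x|\,\varrho_x^{2k+1}+|y|\,\varrho_y^{2k+1}\right),$$ and $\beta=0$ if $xy>0$, or if $xy=0$ and $x+y\ge0$, and $\beta=\frac12$ otherwise.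
   Context: $\Phi(x)=\frac{1}{\sqrt{2\pi}}\int_{-\infty}^x e^{-t^2/2}\,\mathrm{d}t$ is the standard normal distribution function. For $\varrho\in(-1,1)$, the bivariate standard normal distribution function with correlation coefficient $\varrho$ (the superscript $2$ is notation, not a power) is $$\Phi_\varrho^2(x,y)=\frac{1}{2\pi\sqrt{1-\varrho^2}}\int_{-\infty}^x\int_{-\infty}^y e^{-\frac{s^2-2\varrho st+t^2}{2(1-\varrho^2)}}\,\mathrm{d}s\,\mathrm{d}t.$$ For $a>0$, $x\ge0$, $P(a,x)=\frac{1}{\Gamma(a)}\int_0^x t^{a-1}e^{-t}\,\mathrm{d}t$ and $Q(a,x)=\frac{1}{\Gamma(a)}\int_x^\infty t^{a-1}e^{-t}\,\mathrm{d}t$ are the lower and upper regularized gamma functions. $\mathrm{sgn}(x)=1$ if $x\ge0$ and $\mathrm{sgn}(x)=-1$ if $x<0$. Double factorials: $(2k)!!=2^kk!$ (so $0!!=1$), $(2k+1)!!=1\cdot3\cdots(2k+1)$.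
   Formalization: The second identity (with S-tilde) is stated only for xy ≠ 0, since as printed it fails whenever xy = 0 (e.g. x=0, y=1, ϱ=0 gives Φ(1)/2 on the left and 1/4+Φ(1)/2 on the right); the first identity is stated in full, and convergence of both series is added. *)

(* Defs.v *)
(* Written in MathComp / MathComp-Analysis. *)
From HB Require Import structures.
From mathcomp Require Import all_boot all_order all_algebra.
From mathcomp Require Import all_classical all_reals all_analysis.
Set Implicit Arguments.
Unset Strict Implicit.
Unset Printing Implicit Defensive.
Import Order.TTheory GRing.Theory Num.Theory.
Import numFieldNormedType.Exports.
Local Open Scope classical_set_scope.
Local Open Scope ring_scope.

Definition Phi {R : realType} (x : R) : R :=
  (Num.sqrt (2 * pi))^-1 *
  \int[lebesgue_measure]_(t in `]-oo, x]) expR (- (t ^+ 2) / 2).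

(* Bivariate standard normal distribution function with correlation r, for
   -1 < r < 1. *)
Definition Phi2 {R : realType} (r x y : R) : R :=
  (2 * pi * Num.sqrt (1 - r ^+ 2))^-1 *
  \int[lebesgue_measure]_(t in `]-oo, x])
    \int[lebesgue_measure]_(s in `]-oo, y])
      expR (- ((s ^+ 2 - 2 * r * s * t + t ^+ 2) / (2 * (1 - r ^+ 2)))).

Definition Gamma {R : realType} (a : R) : R :=
  \int[lebesgue_measure]_(t in `[0, +oo[) (t `^ (a - 1) * expR (- t)).

(* Lower and upper regularized gamma functions, for a > 0 and x >= 0. *)
Definition gammaP {R : realType} (a x : R) : R :=
  (Gamma a)^-1 *
  \int[lebesgue_measure]_(t in `[0, x]) (t `^ (a - 1) * expR (- t)).

Definition gammaQ {R : realType} (a x : R) : R :=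
  (Gamma a)^-1 *
  \int[lebesgue_measure]_(t in `[x, +oo[) (t `^ (a - 1) * expR (- t)).

(* Unlike Num.sg, this sign function takes the value 1 at 0. *)
Definition sgn {R : realType} (x : R) : R := if 0 <= x then 1 else -1.

Fixpoint dfact (n : nat) : nat :=
  if n is m.+2 then (n * dfact m)%N else 1%N.

Lemma dfactSS (n : nat) : dfact n.+2 = (n.+2 * dfact n)%N.
Proof. by []. Qed.

Lemma dfact_even (k : nat) : dfact (2 * k) = (2 ^ k * k`!)%N.
Proof.
elim: k => [//|k IH].
have -> : (2 * k.+1 = (2 * k).+2)%N by rewrite mulnS.
rewrite dfactSS IH expnS factS.
have -> : ((2 * k).+2 = 2 * k.+1)%N by rewrite mulnS.
by rewrite mulnACA.
Qed.

Lemma dfact_odd (k : nat) :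
  dfact (2 * k + 1) = (\prod_(i < k.+1) (2 * i + 1))%N.
Proof.
elim: k => [|k IH]; first by rewrite big_ord1.
rewrite big_ord_recr -IH [nat_of_ord _]/=.
have -> : (2 * k.+1 + 1 = (2 * k + 1).+2)%N by rewrite mulnS -addnA.
by rewrite dfactSS mulnC.
Qed.

(* Main.v *)
(* Put sigma = sqrt (1 - r^2).  Integrating out one variable gives
   d/dx Phi2 r x y = phi x * Phi ((y - r x) / sigma), and symmetrically in y by
   Tonelli, so the derivative of t |-> Phi2 r (t x) (t y) along a ray is
     x phi(t x) Phi(t (y - r x) / sigma) + y phi(t y) Phi(t (x - r y) / sigma).
   Along the ray rhox and rhoy are constant and q is multiplied by t^2, and
   (y - r x) / sigma = - sgn x * sqrt (2 q) * rhox.  Since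
   Q(k + 1, q) = exp(-q) sum_(j <= k) q^j / j!, the derivative of the n-th partial
   sum of the series with coefficients c'_k is a partial sum of
     sqrt (2 pi) (Phi z - 1/2) = exp(-z^2/2) sum_k z^(2k+1) / (2k+1)!!,
   and the remainder is bounded by an integrable function of t times a null
   sequence.  Integrating from t = 1 to +oo, where all terms have elementary
   limits, yields the identity with S'.  The identity with S follows from
   P + Q = 1 and asin z / sqrt (1 - z^2) = sum_k (2k)!!/(2k+1)!! z^(2k+1); when
   x = 0 or y = 0 the limit along the ray is -1/4 instead of - beta, which is
   compensated by an arcsine of +-1. *)
Require Import Defs.
From HB Require Import structures.
From mathcomp Require Import all_boot all_order all_algebra.
From mathcomp Require Import all_classical all_reals all_analysis.
From mathcomp Require Import measurable_realfun ring lra.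
Import Order.TTheory GRing.Theory Num.Theory.
Import numFieldNormedType.Exports.
Local Open Scope classical_set_scope.
Local Open Scope ring_scope.

Set Implicit Arguments.
Unset Strict Implicit.
Unset Printing Implicit Defensive.

(** * Differentiation rules in pointwise form *)

Section derivative_rules.
Context {R : realType}.
Implicit Types (f g : R -> R) (x c : R).

Lemma is_derive_funD f g x df dg : is_derive x 1 f df -> is_derive x 1 g dg ->
  is_derive x 1 (fun z => f z + g z) (df + dg).
Proof. by move=> ? ?; exact: is_deriveD. Qed.

Lemma is_derive_funN f x df : is_derive x 1 f df ->
  is_derive x 1 (fun z => - f z) (- df).
Proof. by move=> ?; exact: is_deriveN. Qed.

Lemma is_derive_funM f g x df dg : is_derive x 1 f df -> is_derive x 1 g dg ->
  is_derive x 1 (fun z => f z * g z) (f x * dg + g x * df).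
Proof. by move=> ? ?; exact: is_deriveM. Qed.

Lemma is_derive_funX f n x df : is_derive x 1 f df ->
  is_derive x 1 (fun z => f z ^+ n) (n%:R * f x ^+ n.-1 * df).
Proof. by move=> ?; rewrite -exprfctE; exact: is_deriveX. Qed.

Lemma is_derive_fun_cst c x : is_derive x 1 (fun=> c) 0.
Proof. exact: is_derive_cst. Qed.

Lemma is_derive_fun_id x : is_derive x 1 (fun z => z) 1.
Proof. exact: is_derive_id. Qed.

Lemma is_derive_fun_comp g f x dg df : is_derive (f x) 1 g dg ->
  is_derive x 1 f df -> is_derive x 1 (fun z => g (f z)) (dg * df).
Proof. by move=> ? ?; exact: is_derive1_comp. Qed.

Lemma is_derive_fun_sum (n : nat) (h : nat -> R -> R) x (dh : nat -> R) :
  (forall k, is_derive x 1 (h k) (dh k)) ->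
  is_derive x 1 (fun z => \sum_(0 <= k < n) h k z) (\sum_(0 <= k < n) dh k).
Proof.
move=> dhk; elim: n => [|n IH].
  rewrite big_geq//; under eq_fun do rewrite big_geq//.
  exact: is_derive_fun_cst.
rewrite big_nat_recr//=; under eq_fun do rewrite big_nat_recr//=.
exact: is_derive_funD.
Qed.

End derivative_rules.

(* Type class resolution alone also derives these functions, but with [*:] in the
   result, which [ring] and [field] do not normalize. *)
Ltac derive_rules := lazymatch goal with
  | |- is_derive _ _ (fun=> ?c) _ => notypeclasses refine (is_derive_fun_cst _ _)
  | |- is_derive _ _ (fun z => z) _ => notypeclasses refine (is_derive_fun_id _)
  | |- is_derive _ _ (fun z => @?f z + @?g z) _ =>
      notypeclasses refine (@is_derive_funD _ f g _ _ _ _ _); derive_rules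
  | |- is_derive _ _ (fun z => - (@?f z)) _ =>
      notypeclasses refine (@is_derive_funN _ f _ _ _); derive_rules
  | |- is_derive _ _ (fun z => @?f z * @?g z) _ =>
      notypeclasses refine (@is_derive_funM _ f g _ _ _ _ _); derive_rules
  | |- is_derive _ _ (fun z => (@?f z) ^+ ?n) _ =>
      notypeclasses refine (@is_derive_funX _ f n _ _ _); derive_rules
  | |- is_derive _ _ (fun z => ?g (@?f z)) _ =>
      notypeclasses refine (@is_derive_fun_comp _ g f _ _ _ _ _);
        [typeclasses eauto|derive_rules]
  | |- _ => typeclasses eauto
  end.

Ltac derive_eq :=
  notypeclasses refine (is_derive_eq _ _); [derive_rules|cbv beta].

(** * Comparison by derivatives; integrals over left half-lines *)

Section calculus.
Context {R : realType}.
Implicit Types f df : R -> R.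

Lemma is_derive_continuous f df : (forall x : R, is_derive x 1 f (df x)) ->
  continuous f.
Proof.
by move=> dfE x; apply/differentiable_continuous/derivable1_diffP.
Qed.

Lemma is_derive_ge0_le f df (a b : R) : a <= b ->
  (forall x, a <= x <= b -> is_derive x 1 f (df x)) ->
  (forall x, a <= x <= b -> 0 <= df x) -> f a <= f b.
Proof.
move=> ab dfE df0.
have cf : {within `[a, b], continuous f}.
  apply: derivable_within_continuous => x; rewrite in_itv/= => xab.
  by have := dfE _ xab.
have dfE' x : x \in `]a, b[ -> is_derive x 1 f (df x).
  by rewrite in_itv/= => /andP[ax xb]; apply: dfE; rewrite !ltW.
have [c cab fE] := MVT_segment ab dfE' cf.
by rewrite -subr_ge0 fE mulr_ge0 ?subr_ge0// df0//; move: cab; rewrite in_itv.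
Qed.

(** Monotonicity of [g - f]. This comparison of increments takes the place of integrating an
    inequality between derivatives. *)
Lemma is_derive_le f g df dg (a b : R) : a <= b ->
  (forall x, a <= x <= b -> is_derive x 1 f (df x)) ->
  (forall x, a <= x <= b -> is_derive x 1 g (dg x)) ->
  (forall x, a <= x <= b -> df x <= dg x) -> f b - f a <= g b - g a.
Proof.
move=> ab dfE dgE dfg.
have := @is_derive_ge0_le (fun z => g z + - f z) (fun z => dg z + - df z) a b ab.
have H1 x : a <= x <= b ->
    is_derive x 1 (fun z => g z + - f z) (dg x + - df x).
  by move=> xab; apply: is_derive_funD; [exact: dgE|apply/is_derive_funN/dfE].
have H2 x : a <= x <= b -> 0 <= dg x + - df x.
  by move=> xab; rewrite subr_ge0 dfg.
by move=> /(_ H1 H2); lra.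
Qed.

(** The substitution [x -> - x] turns the left half-line into a right one, where the fundamental
    theorem with a limit at infinity applies to [fun z => - F (- z)]. *)
Lemma ge0_continuous_FTC2Ny (f F : R -> R) (b : R) :
  (forall x, 0 <= f x) -> continuous f ->
  (forall x : R, is_derive x 1 F (f x)) ->
  F x @[x --> -oo%R] --> (0 : R) ->
  (\int[lebesgue_measure]_(x in `]-oo, b]) (f x)%:E = (F b)%:E)%E.
Proof.
move=> f0 cf dF FNy.
have cF := is_derive_continuous dF.
rewrite -[b]opprK ge0_integration_by_substitutionNy//; last first.
  exact: continuous_subspaceT.
have dFN (x : R) : is_derive x 1 (fun z => - F (- z)) (f (- x)).
  derive_eq.
  by rewrite mulrN1 opprK.
have cfN : continuous (f \o -%R).
  by move=> x; apply: continuous_comp; [exact: continuousN|exact: cf].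
rewrite (@ge0_continuous_FTC2y _ _ (fun z => - F (- z)) _ 0).
- by rewrite !opprK EFinN oppeK add0e.
- by move=> x _ /=.
- exact: continuous_subspaceT.
- rewrite -oppr0; apply: cvgN.
  exact/(cvgNy_compNP F).
- by move=> x _; have := dFN x.
- by apply/cvg_at_right_filter; exact: is_derive_continuous dFN _.
- by move=> x _; rewrite derive1E derive_val.
Qed.

End calculus.

(** * Standard normal distribution function *)

Section standard_normal.
Context {R : realType}.
Implicit Types x t : R.
Local Notation mu := (@lebesgue_measure R).

Definition gauss t : R := expR (- (t ^+ 2) / 2).

Lemma gauss_ge0 t : 0 <= gauss t. Proof. exact: expR_ge0. Qed.

Lemma gaussN t : gauss (- t) = gauss t.
Proof. by rewrite /gauss sqrrN. Qed.

#[global] Instance is_derive_gauss t : is_derive t 1 gauss (- t * gauss t).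
Proof.
rewrite /gauss; derive_eq.
by rewrite /=; field.
Qed.

Lemma continuous_gauss : continuous gauss.
Proof. exact: is_derive_continuous is_derive_gauss. Qed.

(** Expansion of [0 <= (t + 1) ^+ 2]. The bound has an elementary antiderivative, which serves to
    show that [Phi] vanishes at minus infinity. *)
Lemma gauss_le_expR t : gauss t <= expR (t + 1 / 2).
Proof. by rewrite ler_expR; have := sqr_ge0 (t + 1); rewrite sqrrD; lra. Qed.

Lemma integralT_gauss_sqrt2pi :
  (\int[mu]_t (gauss t)%:E = (Num.sqrt (2 * pi))%:E)%E.
Proof.
pose c : R := Num.sqrt (2 * pi).
have c0 : 0 < c by rewrite sqrtr_gt0 mulr_gt0// pi_gt0.
transitivity (\int[mu]_t (c%:E * (normal_pdf 0 1 t)%:E))%E.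
  apply: eq_integral => t _; rewrite -EFinM; congr EFin.
  rewrite normal_pdfE ?oner_neq0// /normal_peak /normal_fun expr1n mul1r subr0.
  by rewrite -mulr_natl mulrA divff ?gt_eqF// mul1r.
rewrite integralZl//; last exact: integrable_normal_pdf.
by rewrite integral_normal_pdf mule1.
Qed.

Lemma integrable_gauss (D : set (measurableTypeR R)) : measurable D ->
  mu.-integrable D (EFin \o gauss).
Proof.
move=> mD; apply: (@integrableS _ _ _ _ setT) => //.
apply/integrableP; split.
  by apply/measurable_EFinP; exact: continuous_measurable_fun continuous_gauss.
under eq_integral do rewrite /= ger0_norm ?gauss_ge0//.
by rewrite integralT_gauss_sqrt2pi ltry.
Qed.

Lemma integrable_le_gauss (D : set (measurableTypeR R)) (f : R -> R) (C : R) :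
  measurable D ->
  continuous f -> (forall t, `|f t| <= C * gauss t) ->
  mu.-integrable D (EFin \o f).
Proof.
move=> mD cf fC.
have iC : mu.-integrable D (EFin \o (fun t => C * gauss t)).
  exact: (integrableZl mD C (integrable_gauss mD)).
apply: le_integrable iC => //.
  by apply/measurable_EFinP/measurable_funTS; exact: continuous_measurable_fun.
by move=> t _ /=; rewrite lee_fin (le_trans (fC t))// ler_norm.
Qed.

Lemma sqrt2pi_gt0 : 0 < Num.sqrt (2 * pi) :> R.
Proof. by rewrite sqrtr_gt0 mulr_gt0// pi_gt0. Qed.

Lemma PhiE x : Phi x = (Num.sqrt (2 * pi))^-1 *
  \int[mu]_(t in `]-oo, x]) gauss t.
Proof. by []. Qed.

#[global] Instance is_derive_Phi x :
  is_derive x 1 Phi ((Num.sqrt (2 * pi))^-1 * gauss x).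
Proof.
have x1 : x < x + 1 by rewrite ltrDl.
have [] := @continuous_FTC1 R gauss -oo%O x (x + 1) x1
  (integrable_gauss (measurable_itv _)) (ltNyr x) (@continuous_gauss x).
move=> dI IE.
have {}dI : is_derive x 1 (fun y => \int[mu]_(t in `]-oo, y]) gauss t) (gauss x).
  by notypeclasses refine (DeriveDef dI _); rewrite -derive1E IE.
rewrite (_ : Phi = fun y => (Num.sqrt (2 * pi))^-1 *
  \int[mu]_(t in `]-oo, y]) gauss t)//.
notypeclasses refine
  (is_derive_eq (is_derive_funM (is_derive_fun_cst _ _) dI) _).
by rewrite mulr0 addr0.
Qed.

Lemma continuous_Phi : continuous (@Phi R).
Proof. exact: is_derive_continuous is_derive_Phi. Qed.

Lemma Phi_ge0 x : 0 <= Phi x.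
Proof.
rewrite PhiE mulr_ge0 ?invr_ge0 ?sqrtr_ge0//.
by apply: Rintegral_ge0 => t _; exact: gauss_ge0.
Qed.

Lemma Phi_le x y : x <= y -> Phi x <= Phi y.
Proof.
move=> xy; apply: (@is_derive_ge0_le _ _
  (fun z => (Num.sqrt (2 * pi))^-1 * gauss z) _ _ xy) => z _.
by rewrite mulr_ge0 ?gauss_ge0// invr_ge0 sqrtr_ge0.
Qed.

Lemma cvg_expR_Ny : expR x @[x --> -oo%R] --> (0 : R).
Proof. by apply/(cvgNy_compNP expR); exact: cvgr_expR. Qed.

Lemma Phi_le_expR x : Phi x <= (Num.sqrt (2 * pi))^-1 * expR (x + 1 / 2).
Proof.
have I : (\int[mu]_(t in `]-oo, x]) (expR (t + 1 / 2))%:E =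
    (expR (x + 1 / 2))%:E)%E.
  have dE (t : R) : is_derive t 1 (fun z => expR (z + 1 / 2)) (expR (t + 1 / 2)).
    by derive_eq; rewrite addr0 mulr1.
  apply: (ge0_continuous_FTC2Ny (F := fun t => expR (t + 1 / 2))) => //.
  - exact: is_derive_continuous dE.
  - under eq_fun do rewrite expRD.
    by rewrite -(mul0r (expR (1 / 2))); apply: cvgMl; exact: cvg_expR_Ny.
have cE : continuous (fun t : R => expR (t + 1 / 2)).
  move=> t; apply: continuous_comp; last exact: continuous_expR.
  by apply: cvgD; [exact: cvg_id|exact: cvg_cst].
rewrite PhiE ler_wpM2l ?invr_ge0 ?sqrtr_ge0//.
rewrite (_ : expR (x + _) = fine (expR (x + 1 / 2))%:E)// -I.
apply: le_Rintegral => //; first exact: integrable_gauss.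
  apply/integrableP; split.
    by apply/measurable_EFinP/measurable_funTS; exact: continuous_measurable_fun.
  by under eq_integral do rewrite /= ger0_norm ?expR_ge0//; rewrite I ltry.
by move=> t _; exact: gauss_le_expR.
Qed.

Lemma cvg_Phi_Ny : Phi x @[x --> -oo%R] --> (0 : R).
Proof.
apply: (@squeeze_cvgr _ _ _ _ (fun=> 0)
    (fun x => (Num.sqrt (2 * pi))^-1 * expR (1 / 2) * expR x)).
- near=> x; rewrite Phi_ge0/= (le_trans (Phi_le_expR x))//.
  by rewrite addrC expRD mulrA.
- exact: cvg_cst.
- rewrite -[X in _ --> X](mulr0 ((Num.sqrt (2 * pi))^-1 * expR (1 / 2))).
  by apply: cvgMr; exact: cvg_expR_Ny.
Unshelve. all: by end_near. Qed.

(** [gauss] is even, so each half-line carries half of the total mass. *)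
Lemma Phi0 : Phi (0 : R) = 1 / 2.
Proof.
have := integralT_gauss_sqrt2pi.
rewrite ge0_symfun_integralT//; last 3 first.
- exact: gauss_ge0.
- exact: continuous_gauss.
- by move=> t /=; rewrite gaussN.
rewrite -set_itvcy => H.
have : (\int[mu]_(t in `]-oo, 0%R]) (gauss t)%:E =
        \int[mu]_(t in `[0%R, +oo[) (gauss t)%:E)%E.
  rewrite -{1}oppr0 ge0_integration_by_substitutionNy//.
  - by apply: eq_integral => t _ /=; rewrite gaussN.
  - exact/continuous_subspaceT/continuous_gauss.
  - by move=> t _; exact: gauss_ge0.
rewrite PhiE /Rintegral => ->.
have := sqrt2pi_gt0.
(* The half-line integral is an extended real; an infinite value would contradict the finite
   total. *)
move: H; case: (integral _ _ _) => [r| |] /=; last 2 first.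
- by rewrite mulry gtr0_sg// mul1e.
- by rewrite mulrNy gtr0_sg// mul1e.
rewrite -EFinM => -[<-] r0; field; rewrite gt_eqF//.
by move: r0; rewrite pmulr_rgt0.
Qed.

(** The sum [Phi z + Phi (- z)] has derivative [0] everywhere and the value [1] at [0]. *)
Lemma PhiN x : Phi (- x) = 1 - Phi x.
Proof.
have dS (t : R) : is_derive t 1 (fun z => Phi z + Phi (- z)) 0.
  derive_eq.
  by rewrite gaussN; ring.
have /= := is_derive_0_is_cst x 0 dS.
by rewrite oppr0 Phi0; lra.
Qed.

Lemma Phi_le1 x : Phi x <= 1.
Proof. by have := Phi_ge0 (- x); rewrite PhiN subr_ge0. Qed.

Lemma cvg_Phi_y : Phi x @[x --> +oo%R] --> (1 : R).
Proof.
have H : (1 - Phi x) @[x --> -oo%R] --> (1 : R).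
  rewrite -[X in _ --> X](subr0 (1 : R)).
  by apply: cvgB; [exact: cvg_cst|exact: cvg_Phi_Ny].
apply/(cvgy_compNP Phi); rewrite (_ : Phi \o -%R = fun x : R => 1 - Phi x)//.
by apply/funext => x /=; rewrite PhiN.
Qed.

End standard_normal.

(** * Regularized gamma functions at positive integers *)

Section regularized_gamma.
Context {R : realType}.
Local Notation mu := (@lebesgue_measure R).
Implicit Types (k n : nat) (t q : R).

(** The closed form of [gammaQ (k + 1)%:R q] for [0 <= q]: the probability that a Poisson variable
    of mean [q] is at most [k]. *)
Definition poisson_tail k q : R :=
  expR (- q) * \sum_(0 <= j < k.+1) q ^+ j / j`!%:R.

Lemma poisson_tailS k q : poisson_tail k.+1 q =
  poisson_tail k q + expR (- q) * (q ^+ k.+1 / k.+1`!%:R).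
Proof. by rewrite /poisson_tail big_nat_recr//= mulrDr. Qed.

Lemma poisson_tail_at0 k : poisson_tail k 0 = 1.
Proof.
elim: k => [|k IH]; last by rewrite poisson_tailS IH expr0n/= mul0r mulr0 addr0.
by rewrite /poisson_tail big_nat1 expr0 fact0 divr1 oppr0 expR0 mulr1.
Qed.

Lemma factr_neq0 k : k`!%:R != 0 :> R.
Proof. by rewrite pnatr_eq0 -lt0n fact_gt0. Qed.

(** The derivatives of the summands telescope and only the last monomial survives; up to sign and a
    factorial it is the gamma integrand. *)
#[global] Instance is_derive_poisson_tail k q :
  is_derive q 1 (poisson_tail k) (- (expR (- q) * q ^+ k / k`!%:R)).
Proof.
elim: k => [|k IH].
  have -> : poisson_tail 0 = fun q => expR (- q).
    by apply/funext => z; rewrite /poisson_tail big_nat1 expr0 fact0 divr1 mulr1.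
  by derive_eq; rewrite fact0; field.
have -> : poisson_tail k.+1 = fun q =>
    poisson_tail k q + expR (- q) * (q ^+ k.+1 * (k.+1`!%:R)^-1).
  by apply/funext => z; rewrite poisson_tailS.
derive_eq; rewrite /= factS natrM exprS.
by field; rewrite factr_neq0 ?natr1 ?nat1r ?pnatr_eq0.
Qed.

Lemma exprn_div_fact_le_expR n q : 0 <= q -> q ^+ n / n`!%:R <= expR q.
Proof.
move=> q0; case: n => [|n].
  by rewrite expr0 fact0 divr1 (le_trans _ (expR_ge1Dx _))// lerDl.
by apply: le_trans (expR_ge1Dxn n q0); rewrite lerDr.
Qed.

(** One half of the exponential absorbs the power, since [(q / 2)^n / n!] is at most [expR (q / 2)];
    the other half is kept to force decay. *)
Lemma expRN_exprn_le n q : 0 <= q ->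
  expR (- q) * (q ^+ n / n`!%:R) <= 2 ^+ n * expR (- (q / 2)).
Proof.
move=> q0; have -> : - q = - (q / 2) + - (q / 2) by field.
rewrite expRD -mulrA mulrC ler_wpM2r ?expR_ge0// expRN.
rewrite ler_pdivrMl ?expR_gt0//.
have -> : q ^+ n / n`!%:R = 2 ^+ n * ((q / 2) ^+ n / n`!%:R).
  by rewrite -{1}(divfK (_ : 2 != 0 :> R) q)// exprMn; ring.
rewrite mulrC ler_wpM2r ?exprn_ge0//.
by rewrite exprn_div_fact_le_expR// divr_ge0.
Qed.

Lemma cvg_poisson_tail_y k : poisson_tail k q @[q --> +oo%R] --> (0 : R).
Proof.
have H n : expR (- q) * (q ^+ n / n`!%:R) @[q --> +oo%R] --> (0 : R).
  apply: (@squeeze_cvgr _ _ _ _ (fun=> 0) (fun q => 2 ^+ n * expR (- (q / 2)))).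
  - near=> q; have q0 : 0 <= q by near: q; exact: nbhs_pinfty_ge.
    rewrite expRN_exprn_le// andbT mulr_ge0 ?expR_ge0//.
    by rewrite divr_ge0 ?exprn_ge0.
  - exact: cvg_cst.
  - rewrite -[X in _ --> X](mulr0 (2 ^+ n)); apply: cvgMr.
    apply: (@cvg_comp _ _ _ (fun q : R => q / 2) (fun q => expR (- q)) _ +oo%R).
      by apply: gt0_cvgMly; [rewrite invr_gt0|exact: cvg_id].
    exact: cvgr_expR.
elim: k => [|k IH].
  have -> : poisson_tail 0 = fun q => expR (- q) * (q ^+ 0 / 0`!%:R).
    by apply/funext => z; rewrite /poisson_tail big_nat1.
  exact: H.
have -> : poisson_tail k.+1 = fun q =>
    poisson_tail k q + expR (- q) * (q ^+ k.+1 / (k.+1`!%:R)).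
  by apply/funext => z; rewrite poisson_tailS.
by rewrite -[X in _ --> X](addr0 (0 : R)); apply: cvgD; [exact: IH|exact: H].
Unshelve. all: by end_near. Qed.

Lemma powR_expR_integrand k t : 0 <= t ->
  t `^ ((k + 1)%:R - 1) * expR (- t) = expR (- t) * t ^+ k.
Proof. by move=> t0; rewrite natrD addrK powR_mulrn// mulrC. Qed.

Lemma is_derive_expR_exprn k t :
  is_derive t 1 (fun t => - (k`!%:R * poisson_tail k t)) (expR (- t) * t ^+ k).
Proof. by derive_eq; field; exact: factr_neq0. Qed.

Lemma continuous_expR_exprn k : continuous (fun t => expR (- t) * t ^+ k).
Proof.
have d t : is_derive t 1 (fun t => expR (- t) * t ^+ k)
    (expR (- t) * (k%:R * t ^+ k.-1) - expR (- t) * t ^+ k).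
  by derive_eq; ring.
exact: is_derive_continuous d.
Qed.

Lemma integral_gamma_upper k q : 0 <= q ->
  \int[mu]_(t in `[q, +oo[) (t `^ ((k + 1)%:R - 1) * expR (- t)) =
  k`!%:R * poisson_tail k q.
Proof.
move=> q0; transitivity (\int[mu]_(t in `[q, +oo[) (expR (- t) * t ^+ k)).
  apply: eq_Rintegral => t; rewrite inE/= in_itv/= andbT => qt.
  by rewrite powR_expR_integrand// (le_trans q0).
rewrite (@Rintegral_ge0_continuous_FTC2y _ _
  (fun t => - (k`!%:R * poisson_tail k t)) _ 0).
- by rewrite opprK add0r.
- by move=> t qt; rewrite mulr_ge0 ?expR_ge0// exprn_ge0// (le_trans q0).
- exact/continuous_subspaceT/continuous_expR_exprn.
- rewrite -oppr0 -[X in - X](mulr0 k`!%:R).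
  by apply: cvgN; apply: cvgMr; exact: cvg_poisson_tail_y.
- by move=> t _; have := is_derive_expR_exprn k t.
- apply/cvg_at_right_filter.
  exact: is_derive_continuous (is_derive_expR_exprn k) _.
- move=> t _; rewrite derive1E.
  by have dt := is_derive_expR_exprn k t; rewrite derive_val.
Qed.

Lemma Gamma_nat k : Gamma (k + 1)%:R = k`!%:R :> R.
Proof. by rewrite /Gamma integral_gamma_upper// poisson_tail_at0 mulr1. Qed.

Lemma gammaQ_nat k q : 0 <= q -> gammaQ (k + 1)%:R q = poisson_tail k q.
Proof.
move=> q0; rewrite /gammaQ Gamma_nat integral_gamma_upper//.
by rewrite mulKf// factr_neq0.
Qed.

Lemma gammaP_nat k q : 0 < q -> gammaP (k + 1)%:R q = 1 - poisson_tail k q.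
Proof.
move=> q0; rewrite /gammaP Gamma_nat.
have -> : \int[mu]_(t in `[0, q]) (t `^ ((k + 1)%:R - 1) * expR (- t)) =
    \int[mu]_(t in `[0, q]) (expR (- t) * t ^+ k).
  apply: eq_Rintegral => t; rewrite inE/= in_itv/= => /andP[t0 _].
  exact: powR_expR_integrand.
rewrite /Rintegral (@continuous_FTC2 _ _
  (fun t => - (k`!%:R * poisson_tail k t)) _ _ q0).
- rewrite poisson_tail_at0 -EFinB/=; field; exact: factr_neq0.
- exact/continuous_subspaceT/continuous_expR_exprn.
- have cF := is_derive_continuous (is_derive_expR_exprn k).
  split.
  + by move=> t _; have := is_derive_expR_exprn k t.
  + by apply/cvg_at_right_filter; exact: cF.
  + by apply/cvg_at_left_filter; exact: cF.
- move=> t _; rewrite derive1E.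
  by have dt := is_derive_expR_exprn k t; rewrite derive_val.
Qed.

End regularized_gamma.

(** * Power series of [asin z / sqrt (1 - z^2)] *)

Section arcsine_series.
Context {R : realType}.
Implicit Types (k n : nat) (t z : R).

Lemma exprN_odd n z : (- z) ^+ (2 * n + 1) = - z ^+ (2 * n + 1).
Proof. by rewrite exprNn -signr_odd oddD oddM/= expr1 mulN1r. Qed.

Definition dfact_ratio k : R := (dfact (2 * k))%:R / (dfact (2 * k + 1))%:R.

Lemma dfact_gt0 n : (0 < dfact n)%N.
Proof.
have [m] := ubnP n; elim: m n => // m IH [|[|n]]// nm.
by rewrite dfactSS muln_gt0/= IH//; move: nm; rewrite !ltnS => /ltnW.
Qed.

Lemma dfactr_neq0 n : (dfact n)%:R != 0 :> R.
Proof. by rewrite pnatr_eq0 -lt0n dfact_gt0. Qed.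

Lemma dfact_oddS k : dfact (2 * k.+1 + 1) = ((2 * k).+3 * dfact (2 * k + 1))%N.
Proof. by rewrite mulnS !add2n !addSn dfactSS addn1. Qed.

Lemma dfact_ratioS k :
  (2 * k).+3%:R * dfact_ratio k.+1 = (2 * k).+2%:R * dfact_ratio k.
Proof.
rewrite /dfact_ratio dfact_oddS mulnS add2n dfactSS !natrM.
by field; rewrite dfactr_neq0/= -natrM -natrD pnatr_eq0.
Qed.

Lemma dfact_even_le_odd k : (dfact (2 * k) <= dfact (2 * k + 1))%N.
Proof.
elim: k => [//|k IH]; rewrite dfact_oddS mulnS add2n dfactSS.
by rewrite leq_mul.
Qed.

Lemma dfact_ratio_ge0 k : 0 <= dfact_ratio k.
Proof. by rewrite divr_ge0. Qed.

Lemma dfact_ratio_le1 k : dfact_ratio k <= 1.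
Proof.
rewrite ler_pdivrMr ?ltr0n ?dfact_gt0// mul1r ler_nat.
exact: dfact_even_le_odd.
Qed.

Lemma asin0 : asin 0 = 0 :> R.
Proof.
rewrite -[X in asin X]sin0 sinK// in_itv/=.
by have := @pi_ge0 R; lra.
Qed.

Lemma asin1 : asin 1 = pi / 2 :> R.
Proof.
rewrite -[X in asin X]sin_pihalf sinK// in_itv/=.
by have := @pi_ge0 R; lra.
Qed.

Lemma asinN1 : asin (-1) = - (pi / 2) :> R.
Proof.
rewrite -[X in asin (- X)]sin_pihalf -sinN sinK// in_itv/=.
by have := @pi_ge0 R; lra.
Qed.

(** Despite the name, these are partial sums for [asin z / sqrt (1 - z^2)], not for [asin z]. *)
Definition asin_sum n z : R :=
  \sum_(0 <= k < n) dfact_ratio k * z ^+ (2 * k + 1).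

Lemma asin_sumS n z :
  asin_sum n.+1 z = asin_sum n z + dfact_ratio n * z ^+ (2 * n + 1).
Proof. by rewrite /asin_sum big_nat_recr. Qed.

Definition dasin_sum n z : R :=
  \sum_(0 <= k < n) dfact_ratio k * ((2 * k + 1)%:R * z ^+ (2 * k)).

Lemma is_derive_asin_sum n z : is_derive z 1 (asin_sum n) (dasin_sum n z).
Proof.
apply: is_derive_fun_sum => k.
by derive_eq; rewrite addn1/=; ring.
Qed.

(* The partial sums solve the differential equation of [asin z / sqrt (1 - z^2)]
   up to one monomial. *)
Lemma asin_sum_ode n z : (1 - z ^+ 2) * dasin_sum n z =
  1 + z * asin_sum n z - (2 * n + 1)%:R * dfact_ratio n * z ^+ (2 * n).
Proof.
elim: n => [|n IH].
  rewrite /dasin_sum /asin_sum !big_geq// muln0 expr0 /dfact_ratio /= divr1.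
  by rewrite add0n; ring.
rewrite asin_sumS /dasin_sum big_nat_recr//= -/(dasin_sum n z) mulrDr IH.
have -> : (2 * n.+1 + 1)%:R * dfact_ratio n.+1 = (2 * n).+2%:R * dfact_ratio n.
  by rewrite -dfact_ratioS mulnS add2n addn1.
have -> : (2 * n.+1 = (2 * n).+2)%N by rewrite mulnS.
rewrite addn1 !exprS -(addn1 (2 * n).+1) -(addn1 (2 * n)) !natrD.
by ring.
Qed.

(** The factor [sqrt (1 - t^2)] integrates the differential equation: in the derivative of [f]
    below, everything cancels except the monomial from [asin_sum_ode]. Since [f] vanishes at [0],
    comparing derivatives between [0] and [z] gives the bound. *)
Lemma asin_sum_bound n z : -1 < z < 1 ->
  `|Num.sqrt (1 - z ^+ 2) * asin_sum n z - asin z| <=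
  `|z| ^+ (2 * n + 1) / Num.sqrt (1 - z ^+ 2).
Proof.
move=> z1.
have onem_gt0 t : -1 < t < 1 -> 0 < 1 - t ^+ 2 by move=> /andP[? ?]; nra.
have z0 := onem_gt0 _ z1.
pose f t := Num.sqrt (1 - t ^+ 2) * asin_sum n t - asin t.
pose df t := - ((2 * n + 1)%:R * dfact_ratio n * t ^+ (2 * n)) /
  Num.sqrt (1 - t ^+ 2).
have dfE t : -1 < t < 1 -> is_derive t 1 f (df t).
  move=> t1; have t0 := onem_gt0 _ t1.
  have s0 : 0 < Num.sqrt (1 - t ^+ 2) by rewrite sqrtr_gt0.
  have dasin := is_derive1_asin t1.
  have dsqrt : is_derive t 1 (fun z => Num.sqrt (1 - z ^+ 2))
      (- (t / Num.sqrt (1 - t ^+ 2))).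
    have d1 : is_derive t 1 (fun z => 1 - z ^+ 2) (- (2 * t)).
      by derive_eq; rewrite /=; ring.
    notypeclasses refine (is_derive_eq (@is_derive_fun_comp _ Num.sqrt
      (fun z => 1 - z ^+ 2) t _ _ (is_derive1_sqrt t0) d1) _).
    by field; rewrite gt_eqF.
  notypeclasses refine (is_derive_eq (is_derive_funD (is_derive_funM dsqrt
    (is_derive_asin_sum n t)) (is_derive_funN dasin)) _).
  have := asin_sum_ode n t; rewrite /df.
  rewrite -{1}(sqr_sqrtr (ltW t0)) => ode.
  apply: (mulIf (lt0r_neq0 s0)); rewrite divfK ?lt0r_neq0//.
  transitivity (Num.sqrt (1 - t ^+ 2) ^+ 2 * dasin_sum n t -
      t * asin_sum n t - 1).
    by field; rewrite gt_eqF.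
  by rewrite ode; ring.
have sz0 : 0 < Num.sqrt (1 - z ^+ 2) by rewrite sqrtr_gt0.
(* The denominator is frozen at [z], where [1 / sqrt (1 - t^2)] is largest among [|t| <= |z|], so
   that the comparison function is a multiple of a power. *)
pose g t := t ^+ (2 * n + 1) / Num.sqrt (1 - z ^+ 2).
pose dg t := (2 * n + 1)%:R * t ^+ (2 * n) / Num.sqrt (1 - z ^+ 2).
have dgE t : is_derive t 1 g (dg t).
  by rewrite /g; derive_eq; rewrite addn1/= /dg; ring.
have gN t : is_derive t 1 (fun t => - g t) (- dg t) by exact: is_derive_funN.
have even_ge0 t : 0 <= t ^+ (2 * n) by rewrite exprM exprn_ge0// sqr_ge0.
have dfg t : `|t| <= `|z| -> `|df t| <= dg t.
  move=> tz.
  have tz2 : t ^+ 2 <= z ^+ 2.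
    rewrite -(real_normK (num_real t)) -(real_normK (num_real z)).
    by rewrite lerXn2r ?nnegrE.
  rewrite /df normrM normrN !normrM !ger0_norm ?dfact_ratio_ge0//.
  rewrite -/(dfact_ratio n) /dg ler_pM//.
  - by rewrite !mulr_ge0 ?dfact_ratio_ge0.
  - by rewrite ler_wpM2r// ler_piMr// dfact_ratio_le1.
  - rewrite lef_pV2 ?posrE ?sqrtr_gt0//; last by lra.
    by rewrite ler_wsqrtr// lerD2l lerN2.
have f0 : f 0 = 0.
  rewrite /f asin0 subr0 /asin_sum big1 ?mulr0// => k _.
  by rewrite addn1 expr0n mulr0.
have g0 : g 0 = 0 by rewrite /g addn1 expr0n mul0r.
(* General endpoints cover both [[0, z]] and [[z, 0]], according to the sign of [z]. *)
have main a b : a <= b -> `|a| <= `|z| -> `|b| <= `|z| ->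
    `|f b - f a| <= g b - g a.
  move=> ab az bz.
  have inz t : a <= t <= b -> `|t| <= `|z|.
    move=> /andP[at_ tb].
    move: az bz; rewrite !ler_norml => /andP[az1 az2] /andP[bz1 bz2].
    by rewrite (le_trans az1)//= (le_trans tb).
  have in1 t : a <= t <= b -> -1 < t < 1.
    move=> /inz tz; rewrite -ltr_norml (le_lt_trans tz)//.
    by rewrite ltr_norml.
  rewrite ler_norml; apply/andP; split.
    have := @is_derive_le _ (fun t => - g t) f (fun t => - dg t) df a b ab
      (fun t _ => gN t) (fun t tab => dfE t (in1 t tab)).
    have H t : a <= t <= b -> - dg t <= df t.
      by move=> /inz/dfg; rewrite ler_norml => /andP[].
    by move=> /(_ H); lra.
  apply: (is_derive_le ab (fun t tab => dfE t (in1 t tab)) (fun t _ => dgE t)).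
  by move=> t /inz/dfg; rewrite ler_norml => /andP[].
have [z_ge0|z_lt0] := leP 0 z.
  have := main 0 z z_ge0; rewrite normr0 normr_ge0 lexx f0 g0 !subr0.
  by move=> /(_ isT isT); rewrite /g -{2}(ger0_norm z_ge0).
have := main z 0 (ltW z_lt0); rewrite normr0 normr_ge0 lexx f0 g0 !sub0r normrN.
move=> /(_ isT isT) /le_trans; apply.
by rewrite /g (ltr0_norm z_lt0) exprN_odd mulNr.
Qed.

End arcsine_series.

(** * Series of the normal distribution function and its remainder *)

Section gaussian_series.
Context {R : realType}.
Implicit Types (k n : nat) (t : R).
Local Notation sqrt2pi := (Num.sqrt (2 * pi) : R).

Definition gauss_sum n t : R :=
  gauss t * \sum_(0 <= k < n) t ^+ (2 * k + 1) / (dfact (2 * k + 1))%:R.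

Lemma gauss_sumS n t : gauss_sum n.+1 t =
  gauss_sum n t + gauss t * (t ^+ (2 * n + 1) / (dfact (2 * n + 1))%:R).
Proof. by rewrite /gauss_sum big_nat_recr//= mulrDr. Qed.

(* [(2 n + 1) / (2 n + 1)!!] stands for [1 / (2 n - 1)!!] and avoids the
   truncated subtraction at [n = 0]. *)
Lemma is_derive_gauss_sum n t : is_derive t 1 (gauss_sum n)
  (gauss t * (1 - (2 * n + 1)%:R * t ^+ (2 * n) / (dfact (2 * n + 1))%:R)).
Proof.
elim: n => [|n IH].
  have -> : gauss_sum 0 = fun=> 0.
    by apply/funext => z; rewrite /gauss_sum big_geq// mulr0.
  by derive_eq; rewrite muln0 add0n expr0 /= divr1 mulr1 subrr mulr0.
have -> : gauss_sum n.+1 = fun t => gauss_sum n t +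
    gauss t * (t ^+ (2 * n + 1) * (dfact (2 * n + 1))%:R^-1).
  by apply/funext => z; rewrite gauss_sumS.
derive_eq.
have -> : ((2 * n + 1).-1 = 2 * n)%N by rewrite addn1.
rewrite dfact_oddS mulnSr -[(2 * n).+3]addn3 !exprD !natrD natrM.
by field; rewrite dfactr_neq0/= -?natrM -!natrD pnatr_eq0 addn_eq0 andbF.
Qed.

Definition gauss_rest n t : R := sqrt2pi * (Phi t - 1 / 2) - gauss_sum n t.

(** The leading [gauss t] cancels. What remains is one nonnegative term, so the remainder can be
    estimated by monotonicity. *)
Lemma is_derive_gauss_rest n t : is_derive t 1 (gauss_rest n)
  (gauss t * ((2 * n + 1)%:R * t ^+ (2 * n) / (dfact (2 * n + 1))%:R)).
Proof.
have dS := is_derive_gauss_sum n t.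
have c0 := @sqrt2pi_gt0 R.
rewrite /gauss_rest; derive_eq.
by field; rewrite ?dfactr_neq0 gt_eqF.
Qed.

Lemma gauss_rest0 n : gauss_rest n 0 = 0.
Proof.
rewrite /gauss_rest Phi0 subrr mulr0 /gauss_sum big1 ?mulr0 ?subr0// => k _.
by rewrite addn1 expr0n mul0r.
Qed.

Lemma gauss_restN n t : gauss_rest n (- t) = - gauss_rest n t.
Proof.
rewrite /gauss_rest /gauss_sum PhiN gaussN.
under eq_bigr do rewrite exprN_odd mulNr.
by rewrite sumrN; field.
Qed.

Lemma exp2_fact_le_dfact n : (2 ^ n * n`! <= dfact (2 * n + 1))%N.
Proof. by rewrite -dfact_even dfact_even_le_odd. Qed.

(** As [(2n+1)!! >= 2^n n!], the quotient [s^(2n) / (2n+1)!!] in the derivative of the remainder is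
    at most [(s^2/2)^n / n!], hence at most [theta^n exp (s^2 / (2 theta))]. The parameter [theta]
    trades geometric decay in [n] for growth in [t]. *)
Lemma gauss_rest_bound n (theta t : R) : 0 < theta <= 1 ->
  `|gauss_rest n t| <= (2 * n + 1)%:R * theta ^+ n *
     (`|t| * expR ((theta^-1 - 1) * (t ^+ 2 / 2))).
Proof.
move=> /andP[th0 th1].
wlog t0 : t / 0 <= t.
  move=> H; have [/H//|/ltW t0] := leP 0 t.
  by rewrite -normrN -gauss_restN -[`|t|]normrN -sqrrN H// oppr_ge0.
rewrite !ger0_norm//; last first.
  rewrite -(gauss_rest0 n).
  apply: (is_derive_ge0_le t0 (fun s _ => is_derive_gauss_rest n s)) => s _.
  by rewrite mulr_ge0 ?gauss_ge0// divr_ge0// mulr_ge0// exprM exprn_ge0 ?sqr_ge0.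
set c := (2 * n + 1)%:R * theta ^+ n.
pose lam := theta^-1 - 1.
have lam0 : 0 <= lam by rewrite subr_ge0 invf_ge1.
have th_n : 0 < theta ^+ n by rewrite exprn_gt0.
have dB (s : R) : is_derive s 1 (fun s => c * (s * expR (lam * (s ^+ 2 / 2))))
    (c * (expR (lam * (s ^+ 2 / 2)) * (1 + lam * s ^+ 2))).
  by derive_eq; rewrite /=; field.
(* The right-hand side is the derivative of the claimed bound; its factor [1 + lam * s ^+ 2] is at
   least [1] and is estimated by [1]. *)
have df_le (s : R) : gauss s * ((2 * n + 1)%:R * s ^+ (2 * n) /
      (dfact (2 * n + 1))%:R) <=
    c * (expR (lam * (s ^+ 2 / 2)) * (1 + lam * s ^+ 2)).
  have -> : expR (lam * (s ^+ 2 / 2)) = gauss s * expR (s ^+ 2 / 2 / theta).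
    by rewrite /gauss -expRD /lam; congr expR; field; rewrite gt_eqF.
  apply: (@le_trans _ _ (c * (gauss s * expR (s ^+ 2 / 2 / theta)))); last first.
    have : 0 <= gauss s * expR (s ^+ 2 / 2 / theta).
      by apply: mulr_ge0; [exact: gauss_ge0|exact: expR_ge0].
    move: (gauss s * _) => E E0.
    apply: ler_wpM2l; first by rewrite mulr_ge0// ltW.
    by rewrite ler_peMr// lerDl mulr_ge0 ?sqr_ge0.
  have -> : c * (gauss s * expR (s ^+ 2 / 2 / theta)) = gauss s *
      ((2 * n + 1)%:R * (theta ^+ n * expR (s ^+ 2 / 2 / theta))).
    by rewrite /c; ring.
  rewrite -[_ * _ / _]mulrA; apply: ler_wpM2l; first exact: gauss_ge0.
  apply: ler_wpM2l; first exact: ler0n.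
  have u0 : 0 <= s ^+ 2 / 2 / theta.
    by rewrite !divr_ge0 ?sqr_ge0// ltW.
  apply: le_trans (ler_wpM2l (ltW th_n) (exprn_div_fact_le_expR n u0)).
  have -> : theta ^+ n * ((s ^+ 2 / 2 / theta) ^+ n / n`!%:R) =
      s ^+ (2 * n) / (2 ^ n * n`!)%:R.
    rewrite natrM natrX !expr_div_n exprM.
    by field; rewrite factr_neq0 expf_neq0//= gt_eqF.
  rewrite ler_wpM2l//; first by rewrite exprM exprn_ge0// sqr_ge0.
  rewrite lef_pV2 ?posrE ?ltr0n ?dfact_gt0 ?muln_gt0 ?expn_gt0 ?fact_gt0//.
  by rewrite ler_nat exp2_fact_le_dfact.
have := is_derive_le t0 (fun s _ => is_derive_gauss_rest n s) (fun s _ => dB s)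
  (fun s _ => df_le s).
by rewrite gauss_rest0 mul0r mulr0 !subr0.
Qed.

End gaussian_series.

(** * Differentiation of a function of two variables along a ray *)

Section ray_derivative.
Context {R : realType}.

(** A mean value theorem without an order between [a] and [b]; the distance bound forces [c] to tend
    to [a] when [b] does. *)
Lemma MVT_dist (f df : R -> R) (a b : R) :
  (forall x : R, is_derive x 1 f (df x)) ->
  exists c, `|c - a| <= `|b - a| /\ f b - f a = df c * (b - a).
Proof.
move=> dfE; have cf := is_derive_continuous dfE.
have [ab|/ltW ba] := leP a b.
- have [c + fE] := MVT_segment ab (fun x _ => dfE x) (continuous_subspaceT cf).
  rewrite in_itv/= => /andP[ac cb]; exists c; split => //.
  by rewrite !ger0_norm ?subr_ge0// lerD2r.
- have [c + fE] := MVT_segment ba (fun x _ => dfE x) (continuous_subspaceT cf).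
  rewrite in_itv/= => /andP[bc ca]; exists c; split.
    by rewrite !ler0_norm ?subr_le0// lerN2 lerD2r.
  by rewrite -[LHS]opprB fE -mulrN opprB.
Qed.

(* The increment of [G] in its first argument is [gx xi (z * b) * (z - r) * a]
   with [xi] between [r * a] and [z * a], so joint continuity of [gx] suffices. *)
Lemma is_derive_ray (G gx : R -> R -> R) (a b r gy : R) :
  (forall x y : R, is_derive x 1 (G ^~ y) (gx x y)) ->
  is_derive (r * b) 1 (G (r * a)) gy ->
  {for (r * a, r * b), continuous (fun p : R * R => gx p.1 p.2)} ->
  is_derive r 1 (fun z => G (z * a) (z * b)) (a * gx (r * a) (r * b) + b * gy).
Proof.
move=> dGx dGy cgx.
have /choice[xi xiP] : forall z : R, exists c, `|c - r * a| <= `|z * a - r * a| /\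
    G (z * a) (z * b) - G (r * a) (z * b) = gx c (z * b) * (z * a - r * a).
  by move=> z; exact: (MVT_dist _ _ (fun x => dGx x (z * b))).
have -> : (fun z => G (z * a) (z * b)) =
    (fun z => (G (z * a) (z * b) - G (r * a) (z * b)) + G (r * a) (z * b)).
  by apply/funext => z; rewrite subrK.
apply: is_derive_funD; last first.
  have db : is_derive r 1 (fun z => z * b) b by derive_eq; ring.
  notypeclasses refine (is_derive_eq
    (@is_derive_fun_comp _ (G (r * a)) (fun z => z * b) r _ _ dGy db) _).
  exact: mulrC.
have xir : xi r = r * a.
  by have [] := xiP r; rewrite subrr normr0 normr_le0 subr_eq0 => /eqP.
have cza (c : R) : z * c @[z --> r] --> r * c.
  by apply: cvgMl; exact: cvg_id.
have cxi : xi z @[z --> r] --> r * a.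
  apply/cvgrPdist_le => e e0.
  have /cvgrPdist_le/(_ e e0) := cza a.
  apply: filterS => z ze; rewrite distrC; have [+ _] := xiP z.
  by move=> /le_trans; apply; rewrite distrC.
(* In Carathéodory's form, differentiability asks for a slope function continuous at [r], which
   avoids difference quotients. *)
apply/is_derive1_caratheodory; exists (fun z => a * gx (xi z) (z * b)); split.
- move=> z; rewrite (xiP z).2 (subrr (G _ _)) subr0; ring.
- apply: cvgMr.
  apply: (@cvg_comp _ _ _ (fun z => (xi z, z * b)) (fun p => gx p.1 p.2) _
    (nbhs (xi r, r * b))).
    by rewrite xir; exact: (cvg_pair cxi (cza b)).
  by rewrite xir; exact: cgx.
- by rewrite xir.
Qed.

End ray_derivative.

(** * Bivariate normal distribution function: derivatives, symmetry, bounds *)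

Section bivariate_normal.
Context {R : realType}.
Variable r : R.
Hypothesis r1 : -1 < r < 1.
Local Notation mu := (@lebesgue_measure R).
Local Notation sigma := (Num.sqrt (1 - r ^+ 2)).
Local Notation sqrt2pi := (Num.sqrt (2 * pi) : R).
Implicit Types (x y s t : R).

Definition gauss2 s t : R :=
  expR (- ((s ^+ 2 - 2 * r * s * t + t ^+ 2) / (2 * (1 - r ^+ 2)))).

Lemma onemsqr_gt0 : 0 < 1 - r ^+ 2.
Proof. by move/andP: r1 => [? ?]; nra. Qed.

Lemma sigma_gt0 : 0 < sigma. Proof. by rewrite sqrtr_gt0 onemsqr_gt0. Qed.

Lemma gauss2C s t : gauss2 s t = gauss2 t s.
Proof.
rewrite /gauss2; have -> // : s ^+ 2 - 2 * r * s * t + t ^+ 2 =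
  t ^+ 2 - 2 * r * t * s + s ^+ 2 by ring.
Qed.

(** Completing the square in [s]: given [t], the other variable is normal with mean [r * t] and
    standard deviation [sigma]. *)
Lemma gauss2E s t : gauss2 s t = gauss t * gauss ((s - r * t) / sigma).
Proof.
rewrite /gauss2 /gauss -expRD expr_div_n sqr_sqrtr ?(ltW onemsqr_gt0)//.
by congr expR; field; rewrite gt_eqF// onemsqr_gt0.
Qed.

Lemma integral_gauss2 t y : (\int[mu]_(s in `]-oo, y]) (gauss2 s t)%:E =
  (sqrt2pi * sigma * (gauss t * Phi ((y - r * t) / sigma)))%:E)%E.
Proof.
have s0 := sigma_gt0; have c0 := @sqrt2pi_gt0 R.
apply: (ge0_continuous_FTC2Ny
  (F := fun s => sqrt2pi * sigma * (gauss t * Phi ((s - r * t) / sigma)))).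
- by move=> s; exact: expR_ge0.
- have dE s : is_derive s 1 (fun s => gauss t * gauss ((s - r * t) / sigma))
     (gauss t * (- ((s - r * t) / sigma) * gauss ((s - r * t) / sigma) / sigma)).
    by derive_eq; field; rewrite gt_eqF.
  under eq_fun do rewrite gauss2E.
  exact: is_derive_continuous dE.
- move=> s; rewrite gauss2E; derive_eq.
  by field; rewrite !gt_eqF.
- rewrite -[X in _ --> X](mulr0 (sqrt2pi * sigma)); apply: cvgMr.
  rewrite -[X in _ --> X](mulr0 (gauss t)); apply: cvgMr.
  apply: (@cvg_comp _ _ _ (fun s => (s - r * t) / sigma) Phi _ -oo%R).
    apply: gt0_cvgMlNy; first by rewrite invr_gt0.
    exact: cvg_addrr_Ny.
  exact: cvg_Phi_Ny.
Qed.

Lemma continuous_gaussPhi y :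
  continuous (fun t => gauss t * Phi ((y - r * t) / sigma)).
Proof.
have s0 := sigma_gt0; have c0 := @sqrt2pi_gt0 R.
have dE t : is_derive t 1 (fun t => gauss t * Phi ((y - r * t) / sigma))
   (gauss t * (sqrt2pi^-1 * gauss ((y - r * t) / sigma) * (- r / sigma)) +
    (- t * gauss t) * Phi ((y - r * t) / sigma)).
  by derive_eq; field; rewrite !gt_eqF.
exact: is_derive_continuous dE.
Qed.

Lemma integrable_gaussPhi (D : set (measurableTypeR R)) y : measurable D ->
  mu.-integrable D (EFin \o (fun t => gauss t * Phi ((y - r * t) / sigma))).
Proof.
move=> mD.
have le_gauss t : `|gauss t * Phi ((y - r * t) / sigma)| <= 1 * gauss t.
  rewrite mul1r ger0_norm; last by rewrite mulr_ge0 ?gauss_ge0 ?Phi_ge0.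
  by rewrite ler_piMr ?gauss_ge0 ?Phi_le1.
exact: (integrable_le_gauss mD (@continuous_gaussPhi y) le_gauss).
Qed.

Lemma Phi2_Rintegral x y : Phi2 r x y =
  sqrt2pi^-1 * \int[mu]_(t in `]-oo, x]) (gauss t * Phi ((y - r * t) / sigma)).
Proof.
have s0 := sigma_gt0; have c0 := @sqrt2pi_gt0 R.
rewrite /Phi2.
under eq_Rintegral do rewrite /Rintegral integral_gauss2/=.
rewrite RintegralZl//; last exact: integrable_gaussPhi.
rewrite !mulrA; congr (_ * _).
rewrite -{1}(@sqr_sqrtr _ (2 * pi)) ?mulr_ge0 ?pi_ge0//.
by field; rewrite !gt_eqF.
Qed.

Lemma is_derive_Phi2_x x y : is_derive x 1 (fun z => Phi2 r z y)
  (sqrt2pi^-1 * (gauss x * Phi ((y - r * x) / sigma))).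
Proof.
have x1 : x < x + 1 by rewrite ltrDl.
have [] := @continuous_FTC1 R _ -oo%O x (x + 1) x1
  (integrable_gaussPhi y (measurable_itv _)) (ltNyr x) (@continuous_gaussPhi y x).
set I := (fun z => _) => dI IE.
have {}dI : is_derive x 1 I (gauss x * Phi ((y - r * x) / sigma)).
  by notypeclasses refine (DeriveDef dI _); rewrite -derive1E IE.
under eq_fun do rewrite Phi2_Rintegral.
notypeclasses refine
  (is_derive_eq (is_derive_funM (is_derive_fun_cst _ _) dI) _).
by rewrite mulr0 addr0.
Qed.

Lemma integral_indic_mul (D : set (measurableTypeR R)) (h : R -> R) :
  (\int[mu]_(t in D) (h t)%:E = \int[mu]_t (h t * \1_D t)%:E)%E.
Proof.
rewrite integral_mkcond; apply: eq_integral => t _.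
by rewrite patchE indicE; case: ifPn => _; rewrite ?mulr1 ?mulr0.
Qed.

(** Indicators move both domains of integration into the integrand, so that Tonelli's theorem
    applies to one nonnegative measurable function on the plane. *)
Lemma Phi2E x y : Phi2 r x y = (2 * pi * sigma)^-1 *
  fine (\int[mu]_t \int[mu]_s (gauss2 s t * \1_`]-oo, y] s * \1_`]-oo, x] t)%:E)%E.
Proof.
rewrite /Phi2 /Rintegral; congr (_ * fine _).
rewrite integral_indic_mul; apply: eq_integral => t _.
rewrite integral_gauss2 [fine _]/= indicE.
case: (t \in _); last first.
  by rewrite mulr0; apply/esym/integral0_eq => s _; rewrite mulr0.
rewrite mulr1 -integral_gauss2 integral_indic_mul.
by apply: eq_integral => s _; rewrite mulr1.
Qed.

Lemma Phi2C x y : Phi2 r x y = Phi2 r y x.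
Proof.
pose f (z : measurableTypeR R * measurableTypeR R) : \bar R :=
  (gauss2 z.2 z.1 * \1_`]-oo, y] z.2 * \1_`]-oo, x] z.1)%:E.
have mf : measurable_fun setT f.
  apply/measurable_EFinP; apply: measurable_funM; first apply: measurable_funM.
  - apply: measurableT_comp => //.
    apply: measurableT_comp => //.
    apply: measurable_funM => //.
    apply: measurable_funD; last first.
      by apply: measurable_funX; exact: measurable_fst.
    apply: measurable_funB.
      by apply: measurable_funX; exact: measurable_snd.
    apply: measurable_funM; last exact: measurable_fst.
    by apply: measurable_funM => //; exact: measurable_snd.
  - by apply: measurableT_comp => //; exact: measurable_snd.
  - by apply: measurableT_comp => //; exact: measurable_fst.
have f0 z : (0 <= f z)%E.
  by rewrite lee_fin !mulr_ge0// expR_ge0.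
have fubini : (\int[mu]_t \int[mu]_s f (t, s) =
  \int[mu]_s \int[mu]_t f (t, s))%E := fubini_tonelli f mf f0.
have fC : (\int[mu]_s \int[mu]_t f (t, s) = \int[mu]_t \int[mu]_s
    (gauss2 s t * \1_`]-oo, x] s * \1_`]-oo, y] t)%:E)%E.
  apply: eq_integral => s _; apply: eq_integral => t _.
  by rewrite /f/= gauss2C mulrAC.
by rewrite !Phi2E -fC -fubini.
Qed.

Lemma is_derive_Phi2_y x y : is_derive y 1 (Phi2 r x)
  (sqrt2pi^-1 * (gauss y * Phi ((x - r * y) / sigma))).
Proof.
by rewrite (_ : Phi2 r x = fun z => Phi2 r z x);
  [exact: is_derive_Phi2_x|apply/funext => z; exact: Phi2C].
Qed.

Lemma is_derive_Phi2_ray (a b z : R) :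
  is_derive z 1 (fun z => Phi2 r (z * a) (z * b))
   (a * (sqrt2pi^-1 * (gauss (z * a) * Phi (z * (b - r * a) / sigma))) +
    b * (sqrt2pi^-1 * (gauss (z * b) * Phi (z * (a - r * b) / sigma)))).
Proof.
have -> : z * (b - r * a) / sigma = (z * b - r * (z * a)) / sigma by ring.
have -> : z * (a - r * b) / sigma = (z * a - r * (z * b)) / sigma by ring.
apply: (@is_derive_ray _ _
  (fun x y => sqrt2pi^-1 * (gauss x * Phi ((y - r * x) / sigma)))).
- by move=> x y; exact: is_derive_Phi2_x.
- exact: is_derive_Phi2_y.
- apply: cvgMr; apply: cvgM.
    apply: (@continuous_comp _ _ _ fst gauss); first exact: cvg_fst.
    exact: continuous_gauss.
  apply: (@continuous_comp _ _ _ (fun p : R * R => (p.2 - r * p.1) / sigma) Phi).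
    apply: cvgMl; apply: cvgB; first exact: cvg_snd.
    by apply: cvgMr; exact: cvg_fst.
  exact: continuous_Phi.
Qed.

Lemma Phi2_le_x x y : Phi2 r x y <= Phi x.
Proof.
rewrite Phi2_Rintegral PhiE ler_wpM2l ?invr_ge0 ?sqrtr_ge0//.
apply: le_Rintegral => //.
- exact: integrable_gaussPhi.
- exact: integrable_gauss.
- by move=> t _; rewrite ler_piMr ?gauss_ge0 ?Phi_le1.
Qed.

Lemma Phi2_le_y x y : Phi2 r x y <= Phi y.
Proof. by rewrite Phi2C Phi2_le_x. Qed.

Lemma Phi2_ge0 x y : 0 <= Phi2 r x y.
Proof.
rewrite Phi2_Rintegral mulr_ge0 ?invr_ge0 ?sqrtr_ge0//.
by apply: Rintegral_ge0 => t _; rewrite mulr_ge0 ?gauss_ge0 ?Phi_ge0.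
Qed.

(** Only the strip [- e <= t <= m] of the outer integral is kept, and there the inner probability is
    at least [Phi c]. This supplies the lower bound for limits along rays. *)
Lemma Phi2_ge_rectangle x y (e m c : R) : - e <= m -> m <= x ->
  (forall t, - e <= t <= m -> c <= (y - r * t) / sigma) ->
  Phi c * (Phi m - Phi (- e)) <= Phi2 r x y.
Proof.
move=> em mx tc.
have s0 : 0 <= sqrt2pi^-1 by rewrite invr_ge0 sqrtr_ge0.
have mono : Phi2 r m y <= Phi2 r x y.
  apply: (is_derive_ge0_le mx (fun z _ => is_derive_Phi2_x z y)) => z _.
  by apply: mulr_ge0 => //; apply: mulr_ge0; [exact: gauss_ge0|exact: Phi_ge0].
apply: le_trans mono; rewrite mulrBr.
suff : Phi c * Phi m - Phi c * Phi (- e) <= Phi2 r m y - Phi2 r (- e) y.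
  by move=> /le_trans; apply; rewrite lerBlDr lerDl Phi2_ge0.
have dPhi (z : R) : is_derive z 1 (fun z => Phi c * Phi z)
    (Phi c * (sqrt2pi^-1 * gauss z)).
  by derive_eq; ring.
apply: (is_derive_le em (fun z _ => dPhi z) (fun z _ => is_derive_Phi2_x z y)).
move=> z zi; rewrite mulrCA ler_wpM2l// mulrC ler_wpM2l ?gauss_ge0//.
by rewrite Phi_le// tc.
Qed.

End bivariate_normal.

(** * Geometric decay and comparison up to infinity *)

Section comparison.
Context {R : realType}.

(** [1 - s^n] is [1 - s] times the sum of the powers [s^k] with [k < n], each of which is at least
    [s^n]. *)
Lemma mulrn_exprn_le (s : R) n : 0 <= s < 1 -> n%:R * s ^+ n <= (1 - s)^-1.
Proof.
move=> /andP[s0 s1]; have s1' : 0 < 1 - s by rewrite subr_gt0.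
rewrite -[leRHS]mul1r ler_pdivlMr//.
suff : n%:R * s ^+ n * (1 - s) <= 1 - s ^+ n.
  by have := exprn_ge0 n s0; lra.
elim: n => [|n IH]; first by rewrite !mul0r expr0 subrr.
have sn0 := exprn_ge0 n s0.
rewrite -natr1 exprS.
have : (n%:R + 1) * s ^+ n * (1 - s) <= 1 - s * s ^+ n by nra.
have : 0 <= (n%:R + 1) * s ^+ n * (1 - s).
  by apply: mulr_ge0; [apply: mulr_ge0 => //; exact: addr_ge0|exact: ltW].
by nra.
Qed.

(** With [s = u^2], one factor [u^n] keeps [n * u^n] bounded and the other tends to [0]. *)
Lemma cvg_natr_geometric (s : R) : 0 <= s < 1 ->
  (2 * n + 1)%:R * s ^+ n @[n --> \oo] --> (0 : R).
Proof.
move=> /andP[s0 s1]; pose u := Num.sqrt s.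
have u0 : 0 <= u := sqrtr_ge0 s.
have uu : s = u * u by rewrite -expr2 sqr_sqrtr.
have u1 : u < 1 by rewrite -sqrtr1 ltr_sqrt.
have u01 : 0 <= u < 1 by rewrite u0.
apply: (@squeeze_cvgr _ _ _ _ (fun=> 0)
    (fun n => (2 * (1 - u)^-1 + 1) * u ^+ n)).
- apply: nearW => n; apply/andP; split; first by rewrite mulr_ge0// exprn_ge0.
  rewrite uu exprMn mulrA ler_wpM2r ?exprn_ge0//.
  rewrite natrD natrM mulrDl mul1r -mulrA lerD//.
    by rewrite ler_wpM2l// mulrn_exprn_le.
  by rewrite exprn_ile1// ltW.
- exact: cvg_cst.
- by apply: cvg_geometric; rewrite ger0_norm.
Qed.

(** Stands in for integrating [dH] over [[a, +oo[]: the increment of [H] on [[a, M]] is at most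
    [B a - B M <= B a] in absolute value, and [H M] is close to [l] for large [M]. *)
Lemma le_limit_of_derivative (H B dH dB : R -> R) (a l : R) :
  (forall z, a <= z -> is_derive z 1 H (dH z)) ->
  (forall z, a <= z -> is_derive z 1 B (dB z)) ->
  (forall z, a <= z -> `|dH z| <= - dB z) ->
  (forall z, 0 <= B z) ->
  H z @[z --> +oo%R] --> l -> `|H a - l| <= B a.
Proof.
move=> dHE dBE HB B0 Hl; apply/ler_addgt0Pl => e e0.
near (pinfty_nbhs R) => M.
have aM : a <= M by near: M; apply: nbhs_pinfty_ge; exact: num_real.
have HM : `|H M - l| <= e.
  by rewrite distrC; near: M; move/cvgrPdist_le : Hl; apply.
have dN z : a <= z <= M -> is_derive z 1 (fun z => - B z) (- dB z).
  by move=> /andP[az _]; apply: is_derive_funN; exact: dBE.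
have dH' z : a <= z <= M -> is_derive z 1 H (dH z).
  by move=> /andP[az _]; exact: dHE.
have dB' z : a <= z <= M -> is_derive z 1 B (dB z).
  by move=> /andP[az _]; exact: dBE.
have up : H M - H a <= - B M - - B a.
  apply: (is_derive_le aM dH' dN) => z /andP[az _].
  by have := HB z az; rewrite ler_norml => /andP[].
have lo : B M - B a <= H M - H a.
  apply: (is_derive_le aM dB' dH') => z /andP[az _].
  by have := HB z az; rewrite ler_norml opprK => /andP[].
have := B0 M; move: HM; rewrite !ler_norml => /andP[h1 h2] h3.
by apply/andP; split; lra.
Unshelve. all: by end_near. Qed.

End comparison.

(** * Contribution of one coordinate to the series along a ray *)

Section coordinate_series.
Context {R : realType}.
Implicit Types (n k : nat) (c h z t : R).

(** Here [h] will be [sqrt (2 q)] and [z] will be [rhox] or [rhoy]; then [(t * h) ^+ 2 / 2] is [q]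
    multiplied by [t ^+ 2]. *)
Definition tail_sum n h z t : R :=
  \sum_(0 <= k < n) dfact_ratio k * poisson_tail k ((t * h) ^+ 2 / 2) *
    z ^+ (2 * k + 1).

(** In each term [(2k)!! = 2^k k!] cancels the denominators of the Poisson weight, leaving
    [(2k+1)!!]. The hypothesis says [h^2 = c^2 + (h z)^2], which splits the exponential into two
    Gaussian factors. *)
Lemma is_derive_tail_sum n c h z t : c ^+ 2 = h ^+ 2 * (1 - z ^+ 2) ->
  is_derive t 1 (tail_sum n h z)
    (- (h * (gauss (t * c) * gauss_sum n (t * (h * z))))).
Proof.
move=> ch.
have gg : gauss (t * c) * gauss (t * (h * z)) = expR (- ((t * h) ^+ 2 / 2)).
  by rewrite /gauss -expRD; congr expR; rewrite !exprMn ch; field.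
have dk k : is_derive t 1 (fun t => dfact_ratio k *
      poisson_tail k ((t * h) ^+ 2 / 2) * z ^+ (2 * k + 1))
    (- (h * (expR (- ((t * h) ^+ 2 / 2)) *
      ((t * (h * z)) ^+ (2 * k + 1) / (dfact (2 * k + 1))%:R)))).
  have e1 : ((t * h) ^+ 2 / 2) ^+ k = (t * h) ^+ (2 * k) / 2 ^+ k.
    by rewrite expr_div_n exprM.
  have e2 : (t * (h * z)) ^+ (2 * k + 1) =
      (t * h) ^+ (2 * k) * (t * h) * z ^+ (2 * k + 1).
    by rewrite mulrA exprMn exprD expr1.
  derive_eq; rewrite e1 e2 /dfact_ratio dfact_even natrM natrX.
  by field; rewrite factr_neq0 dfactr_neq0 expf_neq0.
notypeclasses refine (is_derive_eq (is_derive_fun_sum n dk) _).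
rewrite /gauss_sum sumrN -mulr_sumr -mulr_sumr.
by rewrite -gg -(mulrA (gauss (t * c))).
Qed.

Lemma cvg_tail_sum n h z : 0 < h -> tail_sum n h z t @[t --> +oo%R] --> (0 : R).
Proof.
move=> h0; elim: n => [|n IH].
  rewrite (_ : tail_sum 0 h z = fun=> 0); first exact: cvg_cst.
  by apply/funext => t; rewrite /tail_sum big_geq.
rewrite (_ : tail_sum n.+1 h z = fun t => tail_sum n h z t + dfact_ratio n *
    poisson_tail n ((t * h) ^+ 2 / 2) * z ^+ (2 * n + 1)); last first.
  by apply/funext => t; rewrite /tail_sum big_nat_recr.
rewrite -[X in _ --> X](addr0 (0 : R)); apply: cvgD; first exact: IH.
rewrite -[X in _ --> X](mul0r (z ^+ (2 * n + 1))); apply: cvgMl.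
rewrite -[X in _ --> X](mulr0 (dfact_ratio n)); apply: cvgMr.
apply: (@cvg_comp _ _ _ (fun t => (t * h) ^+ 2 / 2) (poisson_tail n) _ +oo%R);
  last exact: cvg_poisson_tail_y.
apply: gt0_cvgMly; first by rewrite invr_gt0.
apply: (@cvg_comp _ _ _ (fun t => t * h) (fun t => t ^+ 2) _ +oo%R).
  by apply: gt0_cvgMly => //; exact: cvg_id.
exact: cvgr_expr2.
Qed.

(* For [c != 0], the rate is [theta = (1 + z ^+ 2) / 2]: it lies strictly between
   [z ^+ 2] and [1], so that a Gaussian factor survives. *)
Lemma gauss_rest_geometric c h z : 0 < h -> c ^+ 2 = h ^+ 2 * (1 - z ^+ 2) ->
  exists K theta m : R, [/\ 0 <= K, 0 <= theta < 1, 0 < m &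
    forall n t, 0 <= t ->
      `|c| * (gauss (t * c) * `|gauss_rest n (t * (h * z))|) <=
      K * ((2 * n + 1)%:R * theta ^+ n) * (t * expR (- (m * t ^+ 2)))].
Proof.
(* If [c = 0], then [z ^+ 2 = 1] and no Gaussian decay is available, but the left side vanishes, so
   [K = 0] suffices. *)
move=> h0 ch; have [c0|c0] := eqVneq c 0.
  exists 0, 0, 1; split => //; first by rewrite lexx ltr01.
  by move=> n t _; rewrite c0 normr0 !mul0r.
have c2 : 0 < c ^+ 2 by rewrite exprn_even_gt0.
have h2 : 0 < h ^+ 2 by rewrite exprn_gt0.
have z2 : 0 < 1 - z ^+ 2 by move: c2; rewrite ch pmulr_rgt0.
have zz := sqr_ge0 z.
pose theta := (1 + z ^+ 2) / 2.
have th0 : 0 < theta by rewrite /theta; lra.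
have th1 : theta < 1 by rewrite /theta; lra.
have zth : z ^+ 2 / theta < 1 by rewrite ltr_pdivrMr// /theta; lra.
(* The third witness is the rate left over when [gauss (t * c)] meets the growth factor of
   [gauss_rest_bound]; it is positive because [z ^+ 2 < theta]. *)
exists (`|c| * (h * `|z|)), theta, (h ^+ 2 * (1 - z ^+ 2 / theta) / 2).
split.
- by rewrite !mulr_ge0// ltW.
- by rewrite ltW.
- by rewrite divr_gt0// mulr_gt0// subr_gt0.
move=> n t t0.
have th01 : 0 < theta <= 1 by rewrite th0 ltW.
have := gauss_rest_bound n (t * (h * z)) th01.
set A := `|gauss_rest _ _|; set X := expR _ => AX.
have -> : expR (- (h ^+ 2 * (1 - z ^+ 2 / theta) / 2 * t ^+ 2)) =
    gauss (t * c) * X.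
  rewrite /gauss /X -expRD; congr expR.
  by rewrite !exprMn ch; field; rewrite gt_eqF.
have g0 := gauss_ge0 (t * c).
apply: (@le_trans _ _ (`|c| * (gauss (t * c) * ((2 * n + 1)%:R * theta ^+ n *
    (`|t * (h * z)| * X))))).
  by do 2! apply: ler_wpM2l => //.
rewrite !normrM (ger0_norm t0) (gtr0_norm h0) le_eqVlt; apply/orP; left.
by apply/eqP; ring.
Qed.

End coordinate_series.

(** * Convergence of the series by comparison along a ray *)

Section ray_series.
Context {R : realType}.
Implicit Types (a b h : R).

Lemma sgnK a : a * sgn a = `|a|.
Proof.
rewrite /sgn; case: ifPn => [a0|]; first by rewrite mulr1 ger0_norm.
by rewrite -ltNge => a0; rewrite mulrN1 ltr0_norm.
Qed.

Lemma sqr_sgn a : sgn a ^+ 2 = 1.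
Proof. by rewrite /sgn; case: ifP => _; rewrite ?sqrrN expr1n. Qed.

Lemma Phi_sgn a (t : R) : Phi (- (sgn a * t)) = 1 / 2 - sgn a * (Phi t - 1 / 2).
Proof.
rewrite /sgn; case: ifP => _.
  by rewrite [1 * t]mul1r PhiN; move: (Phi t) => p; field.
by rewrite [-1 * t]mulN1r opprK; move: (Phi t) => p; field.
Qed.

(** [H n] below is the error of the [n]-th partial sum at [(t * a, t * b)]. For every [n] it tends
    to [L] as [t] grows, and its derivative is dominated by that of [B n], so [H n 1] differs from
    [L] by at most [B n 1], which tends to [0]. *)
Lemma ray_series (r a b h za zb L : R) : -1 < r < 1 -> 0 < h ->
  a ^+ 2 = h ^+ 2 * (1 - za ^+ 2) -> b ^+ 2 = h ^+ 2 * (1 - zb ^+ 2) ->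
  (b - r * a) / Num.sqrt (1 - r ^+ 2) = - (sgn a * (h * za)) ->
  (a - r * b) / Num.sqrt (1 - r ^+ 2) = - (sgn b * (h * zb)) ->
  Phi2 r (t * a) (t * b) - 1 / 2 * (Phi (t * a) + Phi (t * b))
    @[t --> +oo%R] --> L ->
  (2 * pi * h)^-1 * (`|a| * tail_sum n h za 1 + `|b| * tail_sum n h zb 1)
    @[n --> \oo] --> Phi2 r a b - 1 / 2 * (Phi a + Phi b) - L.
Proof.
move=> r1 h0 aE bE abE baE HL.
have pi0 : 0 < pi :> R := pi_gt0 R.
pose s2pi : R := Num.sqrt (2 * pi).
have s0 : 0 < s2pi := sqrt2pi_gt0.
have s2 : 2 * pi = s2pi ^+ 2 by rewrite sqr_sqrtr// mulr_ge0// ltW.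
pose T n t := (2 * pi * h)^-1 *
  (`|a| * tail_sum n h za t + `|b| * tail_sum n h zb t).
pose H n t := Phi2 r (t * a) (t * b) - 1 / 2 * (Phi (t * a) + Phi (t * b)) - T n t.
pose E (c z : R) n (t : R) : R :=
  `|c| * (gauss (t * c) * gauss_rest n (t * (h * z))).
pose dH n t := - (2 * pi)^-1 * (E a za n t + E b zb n t).
have dHE n (t : R) : is_derive t 1 (H n) (dH n t).
  have dP := is_derive_Phi2_ray r1 a b t.
  have dTa := is_derive_tail_sum n t aE.
  have dTb := is_derive_tail_sum n t bE.
  have dPhi c : is_derive t 1 (fun t => Phi (t * c))
     (s2pi^-1 * gauss (t * c) * c).
    by derive_eq; rewrite mulr0 add0r mulr1.
  have dPa := dPhi a; have dPb := dPhi b.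
  rewrite /H /T; notypeclasses refine (is_derive_eq
    (is_derive_funD (is_derive_funD dP (is_derive_funN
      (is_derive_funM (is_derive_fun_cst _ _) (is_derive_funD dPa dPb))))
     (is_derive_funN (is_derive_funM (is_derive_fun_cst _ _)
       (is_derive_funD
         (is_derive_funM (is_derive_fun_cst _ _) dTa)
         (is_derive_funM (is_derive_fun_cst _ _) dTb))))) _).
  (* By [Phi_sgn], the constants [1 / 2] cancel against the derivatives of the univariate terms; the
     odd parts combine with the partial sums into [gauss_rest]. *)
  rewrite -!mulrA abE baE !mulrN !(mulrCA t (sgn _)) !Phi_sgn.
  have -> : 2 * (pi * h) = s2pi ^+ 2 * h by rewrite mulrA s2.
  rewrite /dH /E /gauss_rest -/s2pi -(sgnK a) -(sgnK b) s2.
  by field; rewrite !gt_eqF.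
have [Ka [tha [ma [Ka0 tha1 ma0 Ea]]]] := gauss_rest_geometric h0 aE.
have [Kb [thb [mb [Kb0 thb1 mb0 Eb]]]] := gauss_rest_geometric h0 bE.
(* The division by [2 * m] comes from the antiderivative [- exp (- m t^2) / (2 m)] of
   [t exp (- m t^2)]. *)
pose C (K theta m : R) (n : nat) : R :=
   (2 * pi)^-1 * (K * ((2 * n + 1)%:R * theta ^+ n)) / (2 * m).
have C0 K theta m n : 0 <= K -> 0 <= theta < 1 -> 0 < m -> 0 <= C K theta m n.
  move=> K0 /andP[th0 _] m0.
  by rewrite !mulr_ge0 ?invr_ge0 ?mulr_ge0 ?exprn_ge0 ?pi_ge0 // ltW.
pose B n t := C Ka tha ma n * expR (- (ma * t ^+ 2)) +
  C Kb thb mb n * expR (- (mb * t ^+ 2)).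
pose dB n t := - ((2 * pi)^-1 *
  (Ka * ((2 * n + 1)%:R * tha ^+ n) * (t * expR (- (ma * t ^+ 2))) +
   Kb * ((2 * n + 1)%:R * thb ^+ n) * (t * expR (- (mb * t ^+ 2))))).
have dBE n (t : R) : is_derive t 1 (B n) (dB n t).
  rewrite /B; derive_eq; rewrite /= /dB /C.
  by move: (pi) (pi_gt0 R) => p p0; field; rewrite !gt_eqF.
have HB n : `|H n 1 - L| <= B n 1.
  apply: (@le_limit_of_derivative _ (H n) (B n) (dH n) (dB n)) => //.
  - move=> t t1; have t0 : 0 <= t by rewrite (le_trans _ t1).
    rewrite /dH /dB opprK mulNr normrN normrM ger0_norm; last first.
      by rewrite invr_ge0 mulr_ge0// ltW.
    apply: ler_wpM2l; first by rewrite invr_ge0 mulr_ge0// ltW.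
    apply: (le_trans (ler_normD _ _)).
    apply: lerD; rewrite /E normrM normr_id normrM (ger0_norm (gauss_ge0 _)).
      exact: Ea.
    exact: Eb.
  - by move=> t; rewrite addr_ge0// mulr_ge0 ?expR_ge0// C0.
  - rewrite -[X in _ --> X](subr0 L) /H; apply: cvgB; first exact: HL.
    rewrite /T -[X in _ --> X](mulr0 (2 * pi * h)^-1); apply: cvgMr.
    rewrite -[X in _ --> X](addr0 (0 : R)); apply: cvgD.
      rewrite -[X in _ --> X](mulr0 `|a|); apply: cvgMr; exact: cvg_tail_sum.
    rewrite -[X in _ --> X](mulr0 `|b|); apply: cvgMr; exact: cvg_tail_sum.
have cC K theta m : 0 <= theta < 1 -> C K theta m n @[n --> \oo] --> (0 : R).
  move=> th1; rewrite /C -[X in _ --> X](mul0r (2 * m)^-1); apply: cvgMl.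
  rewrite -[X in _ --> X](mulr0 (2 * pi)^-1); apply: cvgMr.
  rewrite -[X in _ --> X](mulr0 K); apply: cvgMr.
  exact: cvg_natr_geometric.
have cB : B n 1 @[n --> \oo] --> (0 : R).
  rewrite -[X in _ --> X](addr0 (0 : R)) /B; apply: cvgD.
    rewrite -[X in _ --> X](mul0r (expR (- (ma * 1 ^+ 2)))).
    by apply: cvgMl; exact: cC.
  rewrite -[X in _ --> X](mul0r (expR (- (mb * 1 ^+ 2)))).
  by apply: cvgMl; exact: cC.
apply/cvgrPdist_le => e e0.
move/cvgrPdist_le : cB => /(_ e e0); apply: filterS => n.
rewrite sub0r normrN; apply: le_trans; apply: le_trans (ler_norm _).
have := HB n; rewrite /H !mul1r => /(le_trans _); apply.
by rewrite le_eqVlt; apply/orP; left; apply/eqP; congr `|_|; rewrite /T; ring.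
Qed.

End ray_series.

(** * Limits of the distribution functions along rays *)

Section ray_limit.
Context {R : realType}.
Implicit Types a b c : R.

Definition Phi_limit c : R := if 0 < c then 1 else if c == 0 then 1 / 2 else 0.

Lemma cvg_Phi_ray c : Phi (t * c) @[t --> +oo%R] --> Phi_limit c.
Proof.
rewrite /Phi_limit; case: (ltgtP 0 c) => [c0|c0|<-].
- apply: (@cvg_comp _ _ _ (fun t => t * c) Phi _ +oo%R).
    by apply: gt0_cvgMly => //; exact: cvg_id.
  exact: cvg_Phi_y.
- rewrite (_ : (fun t => _) = fun t => 1 - Phi (t * - c)); last first.
    by apply/funext => t; rewrite mulrN PhiN; ring.
  rewrite -[X in _ --> X](subrr (1 : R)); apply: cvgB; first exact: cvg_cst.
  apply: (@cvg_comp _ _ _ (fun t => t * - c) Phi _ +oo%R).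
    by apply: gt0_cvgMly; [rewrite oppr_gt0|exact: cvg_id].
  exact: cvg_Phi_y.
- rewrite -Phi0; under eq_fun do rewrite mulr0; exact: cvg_cst.
Qed.

Lemma cvg_Phi2_ray_neg (r a b : R) : -1 < r < 1 -> (a < 0) || (b < 0) ->
  Phi2 r (t * a) (t * b) @[t --> +oo%R] --> (0 : R).
Proof.
move=> r1 /orP[c0|c0].
- apply: (@squeeze_cvgr _ _ _ _ (fun=> 0) (fun t => Phi (t * a))).
  + by apply: nearW => t; rewrite Phi2_ge0//= Phi2_le_x.
  + exact: cvg_cst.
  + by have := @cvg_Phi_ray a; rewrite /Phi_limit ltNge ltW//= lt_eqF.
- apply: (@squeeze_cvgr _ _ _ _ (fun=> 0) (fun t => Phi (t * b))).
  + by apply: nearW => t; rewrite Phi2_ge0//= Phi2_le_y.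
  + exact: cvg_cst.
  + by have := @cvg_Phi_ray b; rewrite /Phi_limit ltNge ltW//= lt_eqF.
Qed.

(** The upper bound is the marginal [Phi (t * a)]. For the lower one, the outer variable is kept
    within [t * (b / 2)] in absolute value; as [|r| <= 1], the inner argument is then at least
    [t * (b / 2 / s)] and the inner probability tends to [1]. *)
Lemma cvg_Phi2_ray_ge0 (r a b : R) : -1 < r < 1 -> 0 <= a -> 0 < b ->
  Phi2 r (t * a) (t * b) @[t --> +oo%R] --> Phi_limit a.
Proof.
(* The minimum keeps the strip below both [t * a] and [t * (b / 2)], and it is zero or positive
   exactly as [a] is. *)
move=> r1 a0 b0; pose m := Num.min a (b / 2).
have b2 : 0 < b / 2 by rewrite divr_gt0.
have m0 : 0 <= m by rewrite le_min a0 ltW.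
have limm : Phi_limit m = Phi_limit a.
  rewrite /m /Phi_limit lt_min b2 andbT.
  case: (ltgtP 0 a) a0 => [//|//|<- _].
  by rewrite min_l ?eqxx// ltW.
have s0 := sigma_gt0 r1.
pose s := Num.sqrt (1 - r ^+ 2).
apply: (@squeeze_cvgr _ _ _ _ (fun t => Phi (t * (b / 2 / s)) *
    (Phi (t * m) - Phi (t * - (b / 2)))) (fun t => Phi (t * a))).
- near=> t; have t0 : 0 <= t by near: t; apply: nbhs_pinfty_ge; exact: num_real.
  rewrite Phi2_le_x// andbT mulrN; apply: Phi2_ge_rectangle => //.
  + by rewrite (@le_trans _ _ 0)// ?oppr_le0 mulr_ge0// ltW.
  + by rewrite ler_wpM2l// ge_min lexx.
  + move=> u /andP[u1 u2]; rewrite mulrA ler_pM2r ?invr_gt0//.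
    have u3 : u <= t * (b / 2).
      by rewrite (le_trans u2)// ler_wpM2l// ge_min lexx orbT.
    have : r * u <= t * (b / 2).
      apply: le_trans (ler_norm _) _; rewrite normrM.
      have : `|u| <= t * (b / 2) by rewrite ler_norml u1.
      have : `|r| <= 1 by rewrite ler_norml !ltW//; case/andP: r1.
      by have := normr_ge0 u; have := normr_ge0 r; nra.
    have : t * b = t * (b / 2) + t * (b / 2) by field.
    by lra.
- rewrite -limm -[Phi_limit m]mul1r -[X in 1 * X]subr0; apply: cvgM.
    have := @cvg_Phi_ray (b / 2 / s).
    by rewrite /Phi_limit divr_gt0.
  apply: cvgB; first exact: cvg_Phi_ray.
  have := @cvg_Phi_ray (- (b / 2)).
  by rewrite /Phi_limit oppr_gt0 ltNge ltW//= oppr_eq0 gt_eqF.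
- exact: cvg_Phi_ray.
Unshelve. all: by end_near. Qed.

(** Nonzero coordinates give [1 - 1], [0 - 0] or [0 - 1/2]. If one coordinate vanishes, the limit is
    [1/2 - 3/4] or [0 - 1/4] by the sign of the other, hence the same in both cases. *)
Lemma cvg_Phi2_ray (r a b : R) : -1 < r < 1 -> (a != 0) || (b != 0) ->
  Phi2 r (t * a) (t * b) - 1 / 2 * (Phi (t * a) + Phi (t * b))
    @[t --> +oo%R] -->
  (if 0 < a * b then 0 else if a * b == 0 then - (1 / 4) else - (1 / 2) : R).
Proof.
move=> r1 ab0.
pose l := if (a < 0) || (b < 0) then 0 else
  if 0 < b then Phi_limit a else Phi_limit b.
have H : Phi2 r (t * a) (t * b) @[t --> +oo%R] --> l.
  rewrite /l; case: ifPn => [|]; first exact: cvg_Phi2_ray_neg.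
  rewrite negb_or -!leNgt => /andP[a0 b0]; case: ifPn => [b1|].
    exact: cvg_Phi2_ray_ge0.
  rewrite -leNgt => b1; have bE : b = 0 by apply/eqP; rewrite eq_le b1.
  have a1 : 0 < a.
    by move: ab0; rewrite bE eqxx orbF lt_neqAle a0 andbT eq_sym.
  under eq_fun do rewrite Phi2C//.
  exact: cvg_Phi2_ray_ge0.
rewrite [X in _ --> X](_ : _ = l - 1 / 2 * (Phi_limit a + Phi_limit b)).
  apply: cvgB => //; apply: cvgMr.
  by apply: cvgD; exact: cvg_Phi_ray.
rewrite /l /Phi_limit.
case: (ltgtP 0 a) ab0 => [a0|a0|<-]; case: (ltgtP 0 b) => [b0|b0|<-] //= _.
- by rewrite mulr_gt0//; lra.
- by rewrite pmulr_rgt0// ltNge ltW//= mulf_eq0 gt_eqF//= lt_eqF//; lra.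
- by rewrite mulr0 ltxx eqxx; lra.
- by rewrite nmulr_rgt0// ltNge ltW//= mulf_eq0 lt_eqF//= gt_eqF//; lra.
- by rewrite nmulr_rgt0// b0; lra.
- by rewrite mulr0 ltxx eqxx; lra.
- by rewrite mul0r ltxx eqxx; lra.
- by rewrite mul0r ltxx eqxx; lra.
Qed.

End ray_limit.

(** * Arcsine limits, including vanishing coordinates *)

Section asin_limit.
Context {R : realType}.

(** The hypothesis gives [|c| = h sqrt (1 - z^2)], which clears the denominator of
    [asin z / sqrt (1 - z^2)]. If [c = 0], then [z] is [1] or [-1] and all terms are zero, so
    [h * asin z] is missing from the limit. *)
Lemma cvg_asin_sum (c h z : R) : 0 < h -> c ^+ 2 = h ^+ 2 * (1 - z ^+ 2) ->
  `|c| * asin_sum n z @[n --> \oo] --> (if c == 0 then 0 else h * asin z).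
Proof.
move=> h0 ch; have [->|c0] := eqVneq c 0.
  by rewrite normr0; under eq_fun do rewrite mul0r; exact: cvg_cst.
have c2 : 0 < c ^+ 2 by rewrite exprn_even_gt0.
have z2 : 0 < 1 - z ^+ 2 by move: c2; rewrite ch pmulr_rgt0// exprn_gt0.
have z1 : `|z| < 1.
  by rewrite -(@ltr_pXn2r _ 2)// ?nnegrE// expr1n real_normK ?num_real// -subr_gt0.
have s0 : 0 < Num.sqrt (1 - z ^+ 2) by rewrite sqrtr_gt0.
have cE : `|c| = h * Num.sqrt (1 - z ^+ 2).
  by rewrite -sqrtr_sqr ch sqrtrM ?sqr_ge0// sqrtr_sqr gtr0_norm.
rewrite cE; under eq_fun do rewrite -mulrA.
apply: cvgMr.
apply/cvgrPdist_le => e e0.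
have zz : `|z ^+ 2| < 1.
  by rewrite ger0_norm ?sqr_ge0// -subr_gt0.
have := @cvg_geometric _ (`|z| / Num.sqrt (1 - z ^+ 2)) _ zz.
move/cvgrPdist_le => /(_ e e0); apply: filterS => n.
rewrite sub0r normrN; apply: le_trans; apply: le_trans (ler_norm _).
rewrite distrC; apply: le_trans (asin_sum_bound n _) _.
  by rewrite -ltr_norml.
rewrite /geometric/= exprD exprM expr1 real_normK ?num_real//.
by rewrite le_eqVlt; apply/orP; left; apply/eqP; ring.
Qed.

(** The arcsine that the series misses when the other coordinate is zero: the conditional on the
    right is then [beta], and [- 1 / 4] is the limit along the ray. *)
Lemma asin_sgn_angle (y : R) : y != 0 ->
  asin (- y / `|y|) / (2 * pi) = (if 0 <= y then 0 else 1 / 2) - 1 / 4.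
Proof.
move=> y0; have := pi_gt0 R.
have [y_ge0|y_lt0] := leP 0 y.
  rewrite ger0_norm// mulNr divff// asinN1; move: (pi) => p p0.
  by field; rewrite gt_eqF.
rewrite ltr0_norm// invrN mulrNN divff// asin1; move: (pi) => p p0.
by field; rewrite gt_eqF.
Qed.

End asin_limit.

(** * Assembly of the two identities *)

Unset Implicit Arguments.

(* The identity with S' fails for x y = 0: at x = 0, y = 1, rho = 0 both series
   vanish while asin rhox = - pi / 2. *)
Theorem corollary2 (R : realType) (x y rho : R)
    (hxy : 0 < x ^+ 2 + y ^+ 2) (hrho : -1 < rho < 1) :
  let D := x ^+ 2 - 2 * rho * x * y + y ^+ 2 in
  let rhox := (rho * x - y) * sgn x / Num.sqrt D in
  let rhoy := (rho * y - x) * sgn y / Num.sqrt D in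
  let q := D / (2 * (1 - rho ^+ 2)) in
  let c := fun k : nat =>
    (dfact (2 * k))%:R / (dfact (2 * k + 1))%:R * gammaP (k + 1)%:R q in
  let c' := fun k : nat =>
    (dfact (2 * k))%:R / (dfact (2 * k + 1))%:R * gammaQ (k + 1)%:R q in
  let u := fun k : nat =>
    c k * (`|x| * rhox ^+ (2 * k + 1) + `|y| * rhoy ^+ (2 * k + 1)) in
  let u' := fun k : nat =>
    c' k * (`|x| * rhox ^+ (2 * k + 1) + `|y| * rhoy ^+ (2 * k + 1)) in
  let S := (2 * pi * Num.sqrt (2 * q))^-1 * limn (series u) in
  let S' := (2 * pi * Num.sqrt (2 * q))^-1 * limn (series u') in
  let beta : R :=
    if (0 < x * y) || ((x * y == 0) && (0 <= x + y)) then 0 else 1 / 2 in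
  [/\ cvgn (series u),
      cvgn (series u'),
      Phi2 rho x y =
        1 / 2 * (Phi x + Phi y) + (asin rhox + asin rhoy) / (2 * pi) - S - beta
    & x * y != 0 ->
      Phi2 rho x y = 1 / 2 * (Phi x + Phi y) + S' - beta].
Proof.
move=> D rhox rhoy q c c' u u' S S' beta.
have s2_gt0 : 0 < 1 - rho ^+ 2 := onemsqr_gt0 hrho.
have s_gt0 := sigma_gt0 hrho.
pose s := Num.sqrt (1 - rho ^+ 2).
have s2E : s ^+ 2 = 1 - rho ^+ 2 by rewrite sqr_sqrtr// ltW.
have D_gt0 : 0 < D.
  rewrite (_ : D = (x - rho * y) ^+ 2 + (1 - rho ^+ 2) * y ^+ 2); last first.
    by rewrite /D; ring.
  have [y0|y0] := eqVneq y 0.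
    by move: hxy; rewrite y0 mulr0 subr0 expr0n/= mulr0.
  by rewrite ltr_wpDl ?sqr_ge0// mulr_gt0// exprn_even_gt0.
have q_gt0 : 0 < q by rewrite divr_gt0// mulr_gt0.
pose h := Num.sqrt (2 * q).
have h_gt0 : 0 < h by rewrite sqrtr_gt0 mulr_gt0.
have h2E : h ^+ 2 = D / s ^+ 2.
  rewrite s2E /h sqr_sqrtr; last by rewrite mulr_ge0// ltW.
  by rewrite /q; move: (D) s2_gt0 => D' ?; field; rewrite gt_eqF.
pose d := Num.sqrt D.
have d_gt0 : 0 < d by rewrite sqrtr_gt0.
have d2E : d ^+ 2 = D by rewrite sqr_sqrtr// ltW.
have dE : d = h * s.
  apply: (pexpIrn (isT : (0 < 2)%N)); rewrite ?nnegrE ?mulr_ge0 ?ltW//.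
  by rewrite exprMn h2E divfK// gt_eqF// exprn_gt0.
(* This rests on [D - (rho * x - y)^2 = (1 - rho^2) * x^2]; [yE] is the same with the coordinates
   exchanged. *)
have xE : x ^+ 2 = h ^+ 2 * (1 - rhox ^+ 2).
  rewrite h2E /rhox -/d !exprMn exprVn sqr_sgn mulr1 d2E.
  rewrite s2E /D; field.
  by rewrite !gt_eqF.
have yE : y ^+ 2 = h ^+ 2 * (1 - rhoy ^+ 2).
  rewrite h2E /rhoy -/d !exprMn exprVn sqr_sgn mulr1 d2E.
  rewrite s2E /D; field.
  by rewrite !gt_eqF.
have cosx : (y - rho * x) / s = - (sgn x * (h * rhox)).
  have := sqr_sgn x; rewrite /rhox -/d dE.
  move: (sgn x) => e e2.
  transitivity (- (e ^+ 2 * (rho * x - y) / s)).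
    by rewrite e2; field; rewrite gt_eqF.
  by field; rewrite !gt_eqF.
have cosy : (x - rho * y) / s = - (sgn y * (h * rhoy)).
  have := sqr_sgn y; rewrite /rhoy -/d dE.
  move: (sgn y) => e e2.
  transitivity (- (e ^+ 2 * (rho * y - x) / s)).
    by rewrite e2; field; rewrite gt_eqF.
  by field; rewrite !gt_eqF.
have xy0 : (x != 0) || (y != 0).
  rewrite -negb_and; apply/negP => /andP[/eqP x0 /eqP y0].
  by move: hxy; rewrite x0 y0 expr0n/= addr0 ltxx.
pose L : R := if 0 < x * y then 0 else if x * y == 0 then - (1 / 4) else - (1 / 2).
have hq : (1 * h) ^+ 2 / 2 = q.
  rewrite mul1r /h sqr_sqrtr; last by rewrite mulr_ge0// ltW.
  by rewrite mulrC mulKf.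
pose V := Phi2 rho x y - 1 / 2 * (Phi x + Phi y) - L.
have series_u' : series u' = fun n =>
    `|x| * tail_sum n h rhox 1 + `|y| * tail_sum n h rhoy 1.
  apply/funext => n; rewrite /series/= /tail_sum !mulr_sumr -big_split/=.
  apply: eq_bigr => k _; rewrite /u' /c' gammaQ_nat ?ltW//.
  rewrite hq -/(dfact_ratio k); move: (dfact_ratio k) (poisson_tail k q) => e p.
  by ring.
have series_u : series u = fun n =>
    `|x| * asin_sum n rhox + `|y| * asin_sum n rhoy - series u' n.
  apply/funext => n; rewrite /series/= /asin_sum !mulr_sumr -big_split/= -sumrB.
  apply: eq_bigr => k _; rewrite /u /c /u' /c' gammaP_nat// gammaQ_nat ?ltW//.
  rewrite -/(dfact_ratio k); move: (dfact_ratio k) (poisson_tail k q) => e p.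
  by ring.
have pi_gt0 := pi_gt0 R.
have p_gt0 : 0 < 2 * pi * h by rewrite !mulr_gt0.
have cvgV : (2 * pi * h)^-1 * series u' n @[n --> \oo] --> V.
  rewrite series_u'.
  exact: (ray_series hrho h_gt0 xE yE cosx cosy (cvg_Phi2_ray hrho xy0)).
have cvgu' : series u' n @[n --> \oo] --> 2 * pi * h * V.
  rewrite (_ : series u' = fun n => 2 * pi * h * ((2 * pi * h)^-1 * series u' n)).
    exact: cvgMr.
  by apply/funext => n; rewrite mulVKf// gt_eqF.
(* At [x = 0] the factor [|x|] annihilates the series, while [asin rhox] is still present in the
   claim. *)
pose ax := if x == 0 then 0 else h * asin rhox.
pose ay := if y == 0 then 0 else h * asin rhoy.
have cvgu : series u n @[n --> \oo] --> ax + ay - 2 * pi * h * V.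
  rewrite series_u; apply: cvgB => //; apply: cvgD.
    exact: cvg_asin_sum.
  exact: cvg_asin_sum.
have SE : S = (ax + ay) / (2 * pi * h) - V.
  by rewrite /S (cvg_lim _ cvgu)// mulrBr mulKf ?gt_eqF// mulrC.
have S'E : S' = V.
  by rewrite /S' (cvg_lim _ cvgu')// mulKf// gt_eqF.
split.
- by apply/cvg_ex; exists (ax + ay - 2 * pi * h * V).
- by apply/cvg_ex; exists (2 * pi * h * V).
(* It remains to match the arcsines without a series counterpart with [L + beta]. For nonzero
   coordinates both sides are [0]; otherwise one arcsine of [1] or [-1] is left. *)
- suff key : (asin rhox + asin rhoy) / (2 * pi) - (ax + ay) / (2 * pi * h) =
      L + beta by rewrite SE /V; lra.
  have cancel (t : R) : h * t / (2 * pi * h) = t / (2 * pi).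
    have : 0 < 2 * pi :> R by rewrite mulr_gt0.
    by move: (2 * pi) => p p0; field; rewrite !gt_eqF.
  rewrite [(_ + _) / (2 * pi)]mulrDl [(_ + _) / (2 * pi * h)]mulrDl /ax /ay.
  have [x0|x0] := eqVneq x 0; last have [y0|y0] := eqVneq y 0.
  + have y0 : y != 0 by move: xy0; rewrite x0 eqxx.
    have rhoxE : rhox = - y / `|y|.
      rewrite /rhox /D x0 /sgn lexx mulr1 mulr0 sub0r.
      by rewrite mulr0 mul0r subr0 expr0n/= add0r sqrtr_sqr.
    rewrite (negbTE y0) cancel mul0r add0r addrK rhoxE asin_sgn_angle//.
    by rewrite /L /beta x0 mul0r ltxx eqxx/= add0r; lra.
  + have rhoyE : rhoy = - x / `|x|.
      rewrite /rhoy /D y0 /sgn lexx mulr1 mulr0 sub0r.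
      by rewrite mulr0 subr0 expr0n/= addr0 sqrtr_sqr.
    rewrite cancel mul0r addr0 [_ / _ + _]addrC addrK rhoyE asin_sgn_angle//.
    by rewrite /L /beta y0 mulr0 ltxx eqxx/= addr0; lra.
  + rewrite !cancel subrr /L /beta mulf_eq0 (negbTE x0) (negbTE y0)/= orbF.
    by case: ifP => _; lra.
(* For a nonzero product the limit [L] along the ray is exactly [- beta]. *)
- move=> xy; rewrite S'E /V /L /beta (negbTE xy) orbF.
  by case: ifP => _; lra.
Qed.
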